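(* Let $R$ be a commutative discrete valuation domain with maximal ideal $(p)$, and let $\Sigma\text{-cyc}(R)$ denote the class of $R$-modules that are direct sums of cyclic torsion $R$-modules (i.e. of modules $R/(p^n)$, $n\ge1$). For $n\ge1$ define the pickets $P^n_0=(R/(p^n),0)$, $P^n_1=(R/(p^n),(p^{n-1})/(p^n))$, $P^n_{n-1}=(R/(p^n),(p)/(p^n))$, $P^n_n=(R/(p^n),R/(p^n))$. Then: (1) If $M\in\Sigma\text{-cyc}(R)$ and $U\subseteq M$ is a submodule with $p(M/U)=0$, then $(M,U)$ is isomorphic to a direct sum of pickets of type $P^n_n$ or $P^n_{n-1}$. (2) If $M\in\Sigma\text{-cyc}(R)$ and $U\subseteq M$ is a submodule with $pU=0$, then $(M,U)$ is isomorphic to a direct sum of pickets of type $P^n_0$ or $P^n_1$ if and only if $M/U\in\Sigma\text{-cyc}(R)$. (3) Every decomposition of such a pair as a direct sum of pickets is unique up to reordering and isomorphism of the summands.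
   Context: A pair $(M,U)$ consists of an $R$-module $M$ and a submodule $U$. A morphism of pairs $(M,U)\to(M',U')$ is an $R$-linear map $f:M\to M'$ with $f(U)\subseteq U'$; isomorphisms are the invertible such morphisms. Direct sums of pairs are taken componentwise: $\bigoplus_i(M_i,U_i)=(\bigoplus_iM_i,\bigoplus_iU_i)$. *)

(* Defs.v *)
From HB Require Import structures.
From Stdlib Require List.
From mathcomp Require Import all_boot all_order all_algebra.
Set Implicit Arguments. Unset Strict Implicit. Unset Printing Implicit Defensive.
Import GRing.Theory.
Local Open Scope ring_scope.

Section PairDefs.
Variable R : idomainType.

Definition dvdR (a b : R) : Prop := exists c : R, b = c * a.

Definition dvr_uniformizer (p : R) : Prop :=
  [/\ p != 0, p \notin GRing.unit &
      forall x : R, x != 0 ->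
        exists (u : R) (e : nat), u \is a GRing.unit /\ x = u * p ^+ e].

Variable p : R.

Definition submod (M : lmodType R) (U : M -> Prop) : Prop :=
  [/\ U 0, (forall x y, U x -> U y -> U (x + y)) &
      (forall (r : R) x, U x -> U (r *: x))].

(* Elements of the external direct sum  (+)_{i in I} R/(p^(n i))  are
   represented by finitely supported functions f : I -> R, modulo the
   relation dsum_eq below (a setoid presentation of the quotients). *)
Definition fsupp (I : Type) (f : I -> R) : Prop :=
  exists s : seq I, forall i, f i <> 0 -> List.In i s.

Definition dsum_eq (I : Type) (n : I -> nat) (f g : I -> R) : Prop :=
  forall i, dvdR (p ^+ n i) (f i - g i).

(* The submodule  (+)_i (p^(n i - k i))/(p^(n i))  of the direct sum, i.e.
   the second component of the direct sum of the pickets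
   P^(n i)_(k i) = (R/(p^(n i)), (p^(n i - k i))/(p^(n i))). *)
Definition dsum_sub (I : Type) (n k : I -> nat) (f : I -> R) : Prop :=
  forall i, dvdR (p ^+ (n i - k i)) (f i).

(* phi induces an R-module isomorphism
     (+)_{i in I} R/(p^(n i))  -->  M / W
   (phi is a set-theoretic lift to M of a map into the quotient M/W). *)
Definition qiso (I : Type) (n : I -> nat) (M : lmodType R) (W : M -> Prop)
  (phi : (I -> R) -> M) : Prop :=
  [/\ (forall f g, fsupp f -> fsupp g ->
         W (phi (fun i => f i + g i) - (phi f + phi g))),
      (forall (r : R) f, fsupp f -> W (phi (fun i => r * f i) - r *: phi f)),
      (forall f g, fsupp f -> fsupp g -> dsum_eq n f g -> W (phi f - phi g)),
      (forall f g, fsupp f -> fsupp g -> W (phi f - phi g) -> dsum_eq n f g) &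
      (forall m : M, exists f, fsupp f /\ W (m - phi f))].

Definition sigma_cyc_quot (M : lmodType R) (W : M -> Prop) : Prop :=
  exists (I : Type) (n : I -> nat),
    (forall i, (0 < n i)%N) /\ exists phi, qiso n W phi.

Definition sigma_cyc (M : lmodType R) : Prop :=
  sigma_cyc_quot (fun x : M => x = 0).

Definition is_picket (n k : nat) : Prop :=
  (0 < n)%N /\ [\/ k = 0%N, k = 1%N, k = (n - 1)%N | k = n].

Definition picket_decomp_by (I : Type) (n k : I -> nat) (M : lmodType R)
  (U : M -> Prop) (phi : (I -> R) -> M) : Prop :=
  [/\ forall i, is_picket (n i) (k i),
      qiso n (fun x : M => x = 0) phi &
      forall m : M, U m <-> exists f, [/\ fsupp f, dsum_sub n k f & phi f = m]].

Definition picket_decomp (M : lmodType R) (U : M -> Prop)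
  (allowed : nat -> nat -> Prop) : Prop :=
  exists (I : Type) (n k : I -> nat) (phi : (I -> R) -> M),
    picket_decomp_by n k U phi /\ forall i, allowed (n i) (k i).

End PairDefs.

(* Main.v *)
Require Import Defs.
From HB Require Import structures.
From mathcomp Require Import all_boot all_order all_algebra.
From mathcomp Require Import zify.
From mathcomp Require Import boolp classical_sets.
Import GRing.Theory.
Local Open Scope ring_scope.

(** A family [z_k] with [p ^+ n_k *: z_k = 0] that generates [M] is a basis as
   soon as, for every [h], the elements [p ^+ h *: z_k] with [n_k = h + 1] are
   independent modulo [p ^+ h.+1 M].  Both existence statements choose such a
   family inside a filtration, so that generation survives unbounded orders.
   - If [pM <= U], let [L_m] be generated by the given cyclic summands of order
     at most [m]; take a basis of [U cap L_(m+1)] modulo [L_m + pM] and complete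
     it by a basis of [L_(m+1)] modulo [U + L_m].
   - If [pU = 0], choose the socle elements [p ^+ h *: z_k]: first a basis of [U],
     then of [M[p]] modulo [U], adapted both to height and to the ascending
     filtrations by order of [M], respectively of [M/U].  The hypothesis on [M/U]
     makes the elements of the [m]-th layer of height at least [m] lie in [U].
   Uniqueness: the summands [P^n_k] of a decomposition index a basis of
   [F(n-1,k) / (F(n,k) + F(n-1,k+1))], where [F(a,c)] is [M[p] cap p^a M] for
   [c = 0] and [M[p] cap p^a M cap p^(c-1) U] otherwise.  Possibly infinite bases
   are compared by a Steinitz exchange argument and Cantor-Bernstein. *)

Set Implicit Arguments.
Unset Strict Implicit.
Unset Printing Implicit Defensive.

(** Zorn's lemma for properties tested on finite sets: a finite subset of the union of a chain lies
    in a single member, so [P] passes to such unions. *)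
Lemma Zorn_finitary (T : eqType) (P : (T -> Prop) -> Prop) :
  P (fun=> False) ->
  (forall A : T -> Prop,
     (forall s : seq T, (forall x, x \in s -> A x) ->
        exists B, [/\ P B, (forall x, B x -> A x) &
                      forall x, x \in s -> B x]) ->
     P A) ->
  exists A, P A /\
    forall B : T -> Prop, (forall x, A x -> B x) -> P B ->
      forall x, B x -> A x.
Proof.
move=> P0 Pfin.
have [F FP Ftot|A [PA Amax]] := @Zorn_bigcup T P.
  apply: Pfin => s sF.
  (* The alternative [B = (fun=> False)] covers the empty [s], since the chain [F] may be empty. *)
  suff [B [sB BF]] : exists B : T -> Prop, (forall x, x \in s -> B x) /\
      (B = (fun=> False) \/ F B).
    exists B; split => //.
    - by case: BF => [->//|/FP].
    - by case: BF => [->//|FB] x Bx; exists B.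
  elim: s sF => [|x s IH] sF; first by exists (fun=> False); split; [|left].
  have [y ys|B [sB BF]] := IH; first by apply: sF; rewrite inE ys orbT.
  have [X FX Xx] : (\bigcup_(X in F) X)%classic x by apply: sF; rewrite mem_head.
  case: BF => [B0|FB].
    exists X; split; last by right.
    by move=> y; rewrite inE => /predU1P[->//|/sB]; rewrite B0.
  have [XB|BX] := Ftot _ _ FX FB.
  - exists B; split; last by right.
    by move=> y; rewrite inE => /predU1P[->|/sB//]; apply: XB.
  - exists X; split; last by right.
    by move=> y; rewrite inE => /predU1P[->//|/sB]; apply: BX.
exists A; split => // B AB PB; apply: contrapT => /existsNP[x /not_implyP[Bx nAx]].
by apply: (Amax B) => //; split => // /(_ _ Bx).
Qed.

(** * Submodules and spans *)

Section Submodules.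
Variables (R : idomainType) (M : lmodType R).
Implicit Types (U V W Y : M -> Prop) (K : eqType).

Lemma submod0 V : submod V -> V 0. Proof. by case. Qed.

Lemma submodD V x y : submod V -> V x -> V y -> V (x + y).
Proof. by case=> _ h _; apply: h. Qed.

Lemma submodZ V r x : submod V -> V x -> V (r *: x).
Proof. by case=> _ _; apply. Qed.

Lemma submodN V x : submod V -> V x -> V (- x).
Proof. by move=> sV Vx; rewrite -scaleN1r; apply: submodZ. Qed.

Lemma submodB V x y : submod V -> V x -> V y -> V (x - y).
Proof. by move=> sV Vx Vy; apply: submodD => //; apply: submodN. Qed.

Lemma submodBC V x y : submod V -> V (x - y) -> V (y - x).
Proof. by move=> sV Vxy; rewrite -opprB; apply: submodN. Qed.

Lemma submod_addKl V x y : submod V -> V x -> V (x + y) -> V y.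
Proof. by move=> sV Vx Vxy; rewrite -(addKr x y) addrC; apply: submodB. Qed.

Lemma submod_sub V x y : submod V -> V (x - y) -> V y -> V x.
Proof. by move=> sV Vxy Vy; rewrite -(subrK y x); apply: submodD. Qed.

Lemma submod_sum V (T : eqType) (s : seq T) (F : T -> M) : submod V ->
  (forall i, i \in s -> V (F i)) -> V (\sum_(i <- s) F i).
Proof.
move=> sV VF; rewrite big_seq; elim/big_ind: _ => //; first exact: submod0.
by move=> x y; apply: submodD.
Qed.

Definition addS V W (x : M) : Prop := exists y z, [/\ V y, W z & x = y + z].

Definition scaleS (r : R) (x : M) : Prop := exists y, x = r *: y.

Lemma submod_zero : submod (fun x : M => x = 0).
Proof.
by split=> // [x y -> ->|r x ->]; rewrite ?addr0 ?scaler0.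
Qed.

Lemma submod_cap V W : submod V -> submod W -> submod (fun x => V x /\ W x).
Proof.
move=> sV sW; split; first by split; apply: submod0.
- by move=> x y [Vx Wx] [Vy Wy]; split; apply: submodD.
- by move=> r x [Vx Wx]; split; apply: submodZ.
Qed.

Lemma submod_add V W : submod V -> submod W -> submod (addS V W).
Proof.
move=> sV sW; split.
- by exists 0, 0; rewrite addr0; split => //; apply: submod0.
- move=> _ _ [x [y [Vx Wy ->]]] [x' [y' [Vx' Wy' ->]]].
  by exists (x + x'), (y + y'); rewrite addrACA; split => //; apply: submodD.
- move=> r _ [x [y [Vx Wy ->]]].
  by exists (r *: x), (r *: y); rewrite scalerDr; split => //; apply: submodZ.
Qed.

Lemma addSl V W x : submod W -> V x -> addS V W x.
Proof. by move=> sW Vx; exists x, 0; rewrite addr0; split => //; apply: submod0. Qed.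

Lemma addSr V W x : submod V -> W x -> addS V W x.
Proof. by move=> sV Wx; exists 0, x; rewrite add0r; split => //; apply: submod0. Qed.

Lemma submod_scale r : submod (scaleS r).
Proof.
split; first by exists 0; rewrite scaler0.
- by move=> _ _ [x ->] [y ->]; exists (x + y); rewrite scalerDr.
- by move=> t _ [x ->]; exists (t *: x); rewrite !scalerA mulrC.
Qed.

Lemma submod_ker r : submod (fun x : M => r *: x = 0).
Proof.
split; first by rewrite scaler0.
- by move=> x y rx ry; rewrite scalerDr rx ry addr0.
- by move=> t x rx; rewrite scalerA mulrC -scalerA rx scaler0.
Qed.

(** Impredicative form of the generated submodule: an inclusion is proved by applying membership to
    the target submodule. *)
Definition span Y (K : Type) (z : K -> M) (D : K -> Prop) (x : M) : Prop :=
  forall V, submod V -> (forall y, Y y -> V y) -> (forall k, D k -> V (z k)) ->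
  V x.

Lemma submod_span Y (K : Type) (z : K -> M) D : submod (span Y z D).
Proof.
split=> [V sV _ _|x y hx hy V sV YV zV|r x hx V sV YV zV].
- exact: submod0.
- by apply: submodD => //; [apply: hx|apply: hy].
- by apply: submodZ => //; apply: hx.
Qed.

Lemma span_base Y (K : Type) (z : K -> M) (D : K -> Prop) y :
  Y y -> span Y z D y.
Proof. by move=> Yy V _ YV _; apply: YV. Qed.

Lemma span_gen Y (K : Type) (z : K -> M) (D : K -> Prop) k :
  D k -> span Y z D (z k).
Proof. by move=> Dk V _ _; apply. Qed.

Lemma span_sub Y Y' (K K' : Type) (z : K -> M) D (z' : K' -> M) D' x :
  (forall y, Y y -> span Y' z' D' y) ->
  (forall k, D k -> span Y' z' D' (z k)) -> span Y z D x -> span Y' z' D' x.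
Proof. by move=> YY' zz' h; apply: h => //; apply: submod_span. Qed.

Lemma sum_mask K (z : K -> M) (s t : seq K) (r : K -> R) :
  uniq s -> uniq t -> {subset s <= t} ->
  \sum_(k <- t) (if k \in s then r k else 0) *: z k = \sum_(k <- s) r k *: z k.
Proof.
move=> us ut st; rewrite (bigID (mem s)) /= [X in _ + X]big1 ?addr0; last first.
  by move=> k /negbTE ->; rewrite scale0r.
rewrite -big_filter (perm_big s) /=; last first.
  apply: uniq_perm => //; first exact: filter_uniq.
  by move=> k; rewrite mem_filter; case: (boolP (k \in s)) => //= /st.
by apply: eq_big_seq => k ->.
Qed.

(** The elements congruent modulo [Y] to a finite combination form a submodule containing the
    generators. Distinct indices are kept so that [indep] applies. *)
Lemma span_sum Y K (z : K -> M) D x : submod Y -> span Y z D x ->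
  exists s r, [/\ uniq s, forall k, k \in s -> D k &
                  Y (x - \sum_(k <- s) r k *: z k)].
Proof.
move=> sY spx.
pose V x := exists s r, [/\ uniq s, forall k, k \in s -> D k &
                  Y (x - \sum_(k <- s) r k *: z k)].
suff: V x by []; apply: spx; last first.
- move=> k Dk; exists [:: k], (fun=> 1); split => //.
    by move=> l; rewrite inE => /eqP->.
  by rewrite big_seq1 scale1r subrr; apply: submod0.
- move=> y Yy; exists [::], (fun=> 0); split => //.
  by rewrite big_nil subr0.
split.
- exists [::], (fun=> 0); split => //.
  by rewrite big_nil subr0; apply: submod0.
- move=> x1 x2 [s1 [r1 [u1 d1 Y1]]] [s2 [r2 [u2 d2 Y2]]].
  pose t := undup (s1 ++ s2).
  have s1t : {subset s1 <= t} by move=> k; rewrite mem_undup mem_cat => ->.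
  have s2t : {subset s2 <= t}.
    by move=> k; rewrite mem_undup mem_cat => ->; rewrite orbT.
  exists t, (fun k => (if k \in s1 then r1 k else 0) +
                      (if k \in s2 then r2 k else 0)).
  split; first exact: undup_uniq.
    by move=> k; rewrite mem_undup mem_cat => /orP[/d1|/d2].
  under eq_bigr do rewrite scalerDl.
  rewrite big_split /= !sum_mask ?undup_uniq // opprD addrACA.
  exact: submodD.
- move=> a x1 [s [r [us d Y1]]]; exists s, (fun k => a * r k); split => //.
  under eq_bigr do rewrite -scalerA.
  by rewrite -scaler_sumr -scalerBr; apply: submodZ.
Qed.

End Submodules.

(** * Linear independence over the residue field *)

Section Independence.
Variables (R : idomainType) (p : R).
Hypothesis hp : dvr_uniformizer p.

(** This is what makes [R/(p)] a field: in [x = u * p ^+ e] either [e = 0] or [p] divides [x]. *)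
Lemma dvdR_or_unit r : dvdR p r \/ r \is a GRing.unit.
Proof.
have [->|r0] := eqVneq r 0; first by left; exists 0; rewrite mul0r.
have [_ _ /(_ _ r0)[u [[|e] [uu ->]]]] := hp; first by right; rewrite mulr1.
by left; exists (u * p ^+ e); rewrite -mulrA -exprSr.
Qed.

Lemma uniformizer_neq0 : p != 0. Proof. by case: hp. Qed.

Lemma dvdR0 (a : R) : dvdR a 0. Proof. by exists 0; rewrite mul0r. Qed.

Lemma dvdRD (a b c : R) : dvdR a b -> dvdR a c -> dvdR a (b + c).
Proof. by move=> [x ->] [y ->]; exists (x + y); rewrite mulrDl. Qed.

Lemma dvdR_mull (a b c : R) : dvdR a b -> dvdR a (c * b).
Proof. by move=> [x ->]; exists (c * x); rewrite mulrA. Qed.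

Lemma dvdR_mulI (a b c : R) : c != 0 -> dvdR (c * a) (c * b) -> dvdR a b.
Proof. by move=> c0 [x]; rewrite mulrCA => /(mulfI c0) ->; exists x. Qed.

Lemma dvdR_exp (m n : nat) (r : R) : (m <= n)%N -> dvdR (p ^+ n) r -> dvdR (p ^+ m) r.
Proof.
by move=> mn [x ->]; exists (x * p ^+ (n - m)); rewrite -mulrA -exprD subnK.
Qed.

Lemma dvdR_expM (m : nat) (r : R) : dvdR (p ^+ m) (p ^+ m * r).
Proof. by exists r; rewrite mulrC. Qed.

Lemma dvdR_exp_cancel (m n : nat) (r : R) :
  (m <= n)%N -> dvdR (p ^+ n) (p ^+ m * r) -> dvdR (p ^+ (n - m)) r.
Proof.
move=> mn h; apply: (@dvdR_mulI _ _ (p ^+ m)); first exact: expf_neq0 uniformizer_neq0.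
by rewrite -exprD subnKC.
Qed.

Lemma not_dvdR1 : ~ dvdR p 1.
Proof.
case: hp => _ /negP up _ [x /esym xp]; apply: up.
by apply/unitrP; exists x; rewrite xp mulrC xp.
Qed.

Section Module.
Variable M : lmodType R.
Implicit Types (U V W Y : M -> Prop) (K : eqType).

(** When all [p *: z k] lie in [Y], this is linear independence over [R/(p)] of the classes modulo
    [Y]: a coefficient vanishes in that field when [p] divides it. *)
Definition indep Y K (z : K -> M) (D : K -> Prop) : Prop :=
  forall s r, uniq s -> (forall k, k \in s -> D k) ->
    Y (\sum_(k <- s) r k *: z k) -> forall k, k \in s -> dvdR p (r k).

Lemma indep_sub Y K (z : K -> M) (D D' : K -> Prop) :
  (forall k, D' k -> D k) -> indep Y z D -> indep Y z D'.
Proof. by move=> DD ind s r us sD; apply: ind => // k /sD/DD. Qed.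

Lemma indep_mono Y Y' K (z : K -> M) (D : K -> Prop) :
  (forall y, Y' y -> Y y) -> indep Y z D -> indep Y' z D.
Proof. by move=> YY ind s r us sD /YY; apply: ind. Qed.

Lemma indep_notin Y K (z : K -> M) (D : K -> Prop) k :
  indep Y z D -> D k -> ~ Y (z k).
Proof.
move=> ind Dk Yk; apply: not_dvdR1; apply: (ind [:: k] (fun=> 1) _ _ _ k) => //.
- by move=> l; rewrite inE => /eqP->.
- by rewrite big_seq1 scale1r.
- exact: mem_head.
Qed.

Lemma indep_map Y (K K' : choiceType) (z : K -> M) (z' : K' -> M) D D'
    (f : K' -> K) :
  indep Y z D -> (forall k, D' k -> D (f k)) ->
  (forall k l, D' k -> D' l -> f k = f l -> k = l) ->
  (forall k, D' k -> z' k = z (f k)) -> indep Y z' D'.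
Proof.
move=> ind DD finj zz' [//|k0 s0] r; set s := k0 :: s0 => us sD Ys k ks.
(* Coefficients transported along [f] through positions in [map f s]; off the image the default [k0]
   is read, but the sum never visits such an index. *)
pose r' l := r (nth k0 s (index l (map f s))).
have finjs : {in s &, injective f} by move=> a b /sD Da /sD Db; apply: finj.
have r'E l : l \in s -> r' (f l) = r l.
  move=> ls; have fl : f l \in map f s by apply: map_f.
  have li : (index (f l) (map f s) < size s)%N by rewrite -(size_map f) index_mem.
  rewrite /r'; congr r; apply: finjs => //; first exact: mem_nth.
  by rewrite -(nth_map _ (f k0)) // nth_index.
rewrite -r'E //; apply: (ind (map f s)).
- by rewrite map_inj_in_uniq.
- by move=> _ /mapP[l ls ->]; apply/DD/sD.
- rewrite big_map; move: Ys; congr Y; apply: eq_big_seq => l ls.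
  by rewrite r'E // zz' //; apply: sD.
- exact: map_f.
Qed.

Lemma sum_filterC K (z : K -> M) (s : seq K) (r : K -> R) (a : pred K) :
  \sum_(k <- s) r k *: z k =
  \sum_(k <- filter a s) r k *: z k + \sum_(k <- filter (predC a) s) r k *: z k.
Proof. by rewrite (bigID a) /= !big_filter. Qed.

(** Modulo [Y'] only the [B]-terms survive, so [p] divides their coefficients; these terms then lie
    in [Y], which leaves a relation among the [A]-terms modulo [Y]. *)
Lemma indep_union Y Y' K (z : K -> M) (A B : K -> Prop) :
  submod Y -> submod Y' -> (forall y, Y y -> Y' y) ->
  (forall k, A k -> Y' (z k)) -> (forall k, B k -> Y (p *: z k)) ->
  indep Y z A -> indep Y' z B -> indep Y z (fun k => A k \/ B k).
Proof.
move=> sY sY' YY' AY pB iA iB s r us sAB; rewrite (sum_filterC _ _ _ (fun k => `[< A k >])).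
set sA := filter _ s; set sB := filter _ s => Ys.
have sAA k : k \in sA -> A k by rewrite mem_filter => /andP[/asboolP].
have sBB k : k \in sB -> B k.
  by rewrite mem_filter => /andP[/asboolPn nA /sAB[]].
have YsA : Y' (\sum_(k <- sA) r k *: z k).
  by apply: submod_sum => // k /sAA/AY; apply: submodZ.
have rB k : k \in sB -> dvdR p (r k).
  apply: iB => //; first exact: filter_uniq.
  exact: (submod_addKl sY' YsA (YY' _ Ys)).
have YsB : Y (\sum_(k <- sB) r k *: z k).
  apply: submod_sum => // k kB; have [c ->] := rB k kB.
  by rewrite -scalerA; apply: submodZ => //; apply/pB/sBB.
have rA k : k \in sA -> dvdR p (r k).
  apply: iA => //; first exact: filter_uniq.
  by move: Ys; rewrite addrC; apply: submod_addKl.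
move=> k ks; have [kA|kA] := boolP (k \in sA); first exact: rA.
by apply: rB; move: kA; rewrite !mem_filter /= ks !andbT.
Qed.

(** Iterates [indep_union] along the ascending filtration [G]; a finite relation meets only
    boundedly many levels. *)
Lemma indep_levels (G : nat -> M -> Prop) Y K (z : K -> M) (D : K -> Prop)
    (lv : K -> nat) :
  submod Y -> (forall t, submod (G t)) -> (forall y, Y y -> G 0%N y) ->
  (forall t y, G t y -> G t.+1 y) ->
  (forall k, D k -> G (lv k).+1 (z k)) -> (forall k, D k -> Y (p *: z k)) ->
  (forall t, indep (G t) z (fun k => D k /\ lv k = t)) -> indep Y z D.
Proof.
move=> sY sG YG GS zG pz iG.
have Gmono m n x : (m <= n)%N -> G m x -> G n x.
  by move=> /subnK <-; elim: (n - m)%N => // d IH /IH; apply: GS.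
have lo t : indep Y z (fun k => D k /\ (lv k < t)%N).
  elim: t => [|t IH]; first by move=> s r _ sD _ k /sD[].
  apply: indep_sub (indep_union sY (sG t) _ _ _ IH (iG t)).
  - by move=> k [Dk]; rewrite ltnS leq_eqVlt => /orP[/eqP|]; [right|left].
  - by move=> y /YG; apply: Gmono.
  - by move=> k [/zG zk lvk]; apply: Gmono lvk zk.
  - by move=> k [/pz].
move=> s r us sD; apply: (lo (\max_(k <- s) lv k).+1) => // k ks.
by split; [exact: sD|rewrite ltnS; exact: leq_bigmax_seq].
Qed.

(** A relation modulo the span of [B] is a relation modulo [Y] once the [B]-terms are moved to the
    other side. *)
Lemma indep_span Y K (z : K -> M) (A B : K -> Prop) :
  submod Y -> indep Y z (fun k => A k \/ B k) -> (forall k, A k -> ~ B k) ->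
  indep (span Y z B) z A.
Proof.
move=> sY ind AB s r us sA /(span_sum sY)[t [q [ut tB Yt]]] k ks.
have st l : l \in s -> (l \in t) = false.
  by move=> ls; apply/negP => /tB; apply: AB; apply: sA.
rewrite (_ : r k = if k \in s then r k else - q k); last by rewrite ks.
apply: (ind (s ++ t) (fun k => if k \in s then r k else - q k)).
- rewrite cat_uniq us ut andbT; apply/hasPn => l lt.
  by apply/negP => /st; rewrite lt.
- by move=> l; rewrite mem_cat => /orP[/sA|/tB]; [left|right].
- rewrite big_cat /=; move: Yt; congr Y; rewrite -sumrN; congr (_ + _).
    by apply: eq_big_seq => l ->.
  apply: eq_big_seq => l lt; rewrite -scaleNr ifN //.
  by apply/negP => /st; rewrite lt.
- by rewrite mem_cat ks.
Qed.

(** If [p] did not divide the coefficient of [z k0], it would be a unit, and inverting it would put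
    [z k0] in the span. *)
Lemma indep_extend Y K (z : K -> M) (D : K -> Prop) k0 :
  submod Y -> indep Y z D -> Y (p *: z k0) -> ~ span Y z D (z k0) ->
  indep Y z (fun k => D k \/ k = k0).
Proof.
move=> sY iD pk0 nk0.
apply: (indep_union sY (@submod_span _ _ Y _ z D)) => //.
- by move=> y; apply: span_base.
- by move=> k; apply: span_gen.
- by move=> k ->.
move=> s r us sk Ys k ks; have := sk k ks => kk0; rewrite {}kk0 in ks *.
have [//|ur] := dvdR_or_unit (r k0); case: nk0.
have sE : perm_eq s [:: k0].
  apply: uniq_perm => // l; rewrite inE; apply/idP/eqP => [/sk//|->//].
move: Ys; rewrite (perm_big _ sE) big_seq1 => /(submodZ (r k0)^-1 (submod_span Y z D)).
by rewrite scalerA mulVr // scale1r.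
Qed.

(** A basis inside a given family: independence is a finitary property, so a maximal independent
    subfamily exists, and by [indep_extend] it spans. *)
Lemma maximal_indep Y K (z : K -> M) (D : K -> Prop) :
  submod Y -> (forall k, D k -> Y (p *: z k)) ->
  exists A, [/\ forall k, A k -> D k, indep Y z A &
                forall k, D k -> span Y z A (z k)].
Proof.
move=> sY pz.
pose P (A : K -> Prop) := (forall k, A k -> D k) /\ indep Y z A.
have [||A [[AD iA] Amax]] := @Zorn_finitary K P.
- by split=> // s r _ s0 _ k /s0.
- move=> A Afin; split=> [k Ak|s r us sA].
    have [|B [[BD _] _ kB]] := Afin [:: k].
      by move=> l; rewrite inE => /eqP->.
    by apply/BD/kB; rewrite mem_head.
  by have [B [[_ iB] _ sB]] := Afin s sA; apply: iB.
exists A; split => // k Dk; apply: contrapT => nk; apply: (nk).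
apply: span_gen; apply: (Amax (fun l => A l \/ l = k)); [by left| |by right].
split; first by move=> l [/AD//|->].
by apply: indep_extend => //; apply: pz.
Qed.

End Module.
End Independence.

(** The second conclusion lets [sigma] inherit any labelling preserved by both [f] and [g]. On the
    closure [X] of the complement of the image of [g] under [g] after [f], [sigma] is [f]; elsewhere
    it inverts [g]. *)
Lemma Cantor_Bernstein_choice (I J : Type) (f : I -> J) (g : J -> I) :
  injective f -> injective g ->
  exists sigma : I -> J,
    bijective sigma /\ forall i, sigma i = f i \/ g (sigma i) = i.
Proof.
move=> fI gI.
pose X i := forall P : I -> Prop, (forall i, ~ (exists j, g j = i) -> P i) ->
  (forall i, P i -> P (g (f i))) -> P i.
have Xout i : ~ (exists j, g j = i) -> X i by move=> ni P P0 _; exact: P0.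
have Xgf i : X i -> X (g (f i)) by move=> Xi P P0 PS; exact: PS (Xi P P0 PS).
have XgfI j : X (g j) -> exists2 i, X i & j = f i.
  move=> Xg; suff [[]|[i Xi /gI]] : ~ (exists l, g l = g j) \/
      exists2 i, X i & g j = g (f i) by [exists j|exists i].
  apply: (Xg (fun k => ~ (exists l, g l = k) \/ exists2 i, X i & k = g (f i))).
    by move=> i; left.
  move=> i [ni|[l Xl ->]]; right; first by exists i => //; apply: Xout.
  by exists (g (f l)) => //; apply: Xgf.
have /choice[s sP] i : exists j, (X i -> j = f i) /\ (~ X i -> g j = i).
  have [Xi|nXi] := pselect (X i); first by exists (f i).
  have [[j ji]|/Xout//] := pselect (exists j, g j = i).
  by exists j.
have sX i : X i -> s i = f i by case: (sP i).
have snX i : ~ X i -> g (s i) = i by case: (sP i).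
have sI : injective s.
  move=> i l; have [Xi|nXi] := pselect (X i); have [Xl|nXl] := pselect (X l).
  - by rewrite !sX // => /fI.
  - by rewrite (sX i Xi) => fs; case: (nXl); rewrite -(snX l nXl) -fs; apply: Xgf.
  - by rewrite (sX l Xl) => fs; case: (nXi); rewrite -(snX i nXi) fs; apply: Xgf.
  - by move=> sil; rewrite -(snX i nXi) sil snX.
have /choice[t tP] j : exists i, s i = j.
  have [Xg|nXg] := pselect (X (g j)).
    by have [i Xi ->] := XgfI _ Xg; exists i; apply: sX.
  by exists (g j); apply: gI; apply: snX.
exists s; split; first by exists t => // i; apply: sI.
by move=> i; have [/sX|/snX] := pselect (X i); [left|right].
Qed.

(** * Steinitz exchange for possibly infinite families *)

Section Exchange.
Variables (R : idomainType) (p : R).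
Hypothesis hp : dvr_uniformizer p.
Variables (M : lmodType R) (Y : M -> Prop).
Hypothesis sY : submod Y.
Variables (I J : choiceType) (z : I -> M) (w : J -> M).
Variables (D : I -> Prop) (E : J -> Prop).

Let zw (k : I + J) := match k with inl i => z i | inr j => w j end.

Let mixed (G : I * J -> Prop) (k : I + J) : Prop :=
  match k with
  | inl i => D i /\ ~ (exists j, G (i, j))
  | inr j => exists i, G (i, j)
  end.

(* Zorn's lemma runs over the partial injections [G] from [D] to [E] such that
   [D] with the domain of [G] replaced by its range is still independent. *)
Lemma exchange :
  indep p Y z D -> (forall j, E j -> Y (p *: w j)) ->
  (forall i, D i -> span Y w E (z i)) ->
  exists G : I -> J -> Prop,
    [/\ forall i, D i -> exists j, G i j,
        forall i j, G i j -> E j &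
        forall i i' j, G i j -> G i' j -> i = i'].
Proof.
move=> iD pw Dw.
pose P (G : I * J -> Prop) :=
  [/\ forall i j, G (i, j) -> E j,
      forall i j j', G (i, j) -> G (i, j') -> j = j',
      forall i i' j, G (i, j) -> G (i', j) -> i = i' & indep p Y zw (mixed G)].
have [||G [[GE Gf Gi iG] Gmax]] := @Zorn_finitary _ P.
(* For empty [G] the mixed family is [D] itself; [i0] is only a default for the indices [inr j],
   which do not occur. *)
- split=> // -[//|[i0|j0] s] r us sD; last by case: (sD _ (mem_head _ _)) => ? [].
  apply: (indep_map (f := fun k : I + J => if k is inl i then i else i0) iD) us sD.
  - by move=> [i []//|j [? []]].
  - by move=> [i|j] [i'|j'] /=; [move=> _ _ ->|move=> _ [? []]|move=> [? []]|move=> [? []]].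
  - by move=> [i|j] //= [? []].
- move=> G Gfin; split.
  + move=> i j Gij; have [|B [[BE _ _ _] _]] := Gfin [:: (i, j)].
      by move=> ij; rewrite inE => /eqP->.
    by move=> /(_ _ (mem_head _ _))/BE.
  + move=> i j j' Gij Gij'; have [|B [[_ Bf _ _] _ sB]] := Gfin [:: (i, j); (i, j')].
      by move=> ij; rewrite !inE => /orP[]/eqP->.
    by apply: (Bf i); apply: sB; rewrite !inE eqxx ?orbT.
  + move=> i i' j Gij Gij'; have [|B [[_ _ Bi _] _ sB]] := Gfin [:: (i, j); (i', j)].
      by move=> ij; rewrite !inE => /orP[]/eqP->.
    by apply: (Bi _ _ j); apply: sB; rewrite !inE eqxx ?orbT.
  + move=> s r us sG.
    (* Finitely many pairs of [G] account for the indices [inr j] in [s]. A stage [B] below [G]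
       containing them has all of [s] among its mixed indices. *)
    have [t [tG st]] : exists t : seq (I * J), (forall ij, ij \in t -> G ij) /\
        forall j, inr j \in s -> exists i, (i, j) \in t.
      elim: s sG {us} => [|k s IH] sG; first by exists [::].
      have [l ls|t [tG st]] := IH; first by apply: sG; rewrite inE ls orbT.
      case: k sG => [i|j] sG.
        by exists t; split => // j; rewrite inE => /= /st.
      have [i Gij] := sG _ (mem_head _ _).
      exists ((i, j) :: t); split; first by move=> ij; rewrite inE => /predU1P[->|/tG].
      move=> l; rewrite inE => /predU1P[[->]|/st[i' it]].
        by exists i; rewrite mem_head.
      by exists i'; rewrite inE it orbT.
    have [B [[_ _ _ iB] BG tB]] := Gfin t tG; apply: iB => // -[i|j] ks.
      by have [Di nG] := sG _ ks; split=> // -[j /BG Gij]; apply: nG; exists j.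
    by have [i /tB] := st j ks; exists i.
exists (fun i j => G (i, j)); split => // b Db; apply: contrapT => nb.
(* Let [b] be unmatched and remove it from the mixed family. Then [z b] is outside the span of the
   rest, hence so is some [w c]; adding [(b, c)] to [G] contradicts maximality. *)
pose B k := mixed G k /\ k <> inl b.
have bB : ~ span Y zw B (z b).
  apply: (@indep_notin _ _ hp _ _ _ zw (fun k => k = inl b) (inl b)) => //.
  apply: indep_span => // [|k -> []//].
  by apply: indep_sub iG => k [->//|[]].
have [c Ec nc] : exists2 c, E c & ~ span Y zw B (w c).
  apply: contrapT => nc; apply: bB; apply: span_sub (Dw b Db).
    by move=> y; apply: span_base.
  by move=> c Ec; apply: contrapT => ncs; apply: nc; exists c.
have cG i : ~ G (i, c).
  by move=> Gic; apply: nc; apply: (@span_gen _ _ _ _ zw B (inr c)); split=> //; exists i.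
apply: (nb); exists c; apply: (Gmax (fun ij => G ij \/ ij = (b, c))); [by left| |by right].
split.
- by move=> i j [/GE//|[_ ->]].
- move=> i j j' [Gij|[-> ->]] [Gij'|[]].
  + exact: Gf Gij Gij'.
  + by move=> ib _; case: nb; exists j; rewrite -ib.
  + by case: nb; exists j'.
  + by [].
- move=> i i' j [Gij|[-> ->]] [Gij'|[]].
  + exact: Gi Gij Gij'.
  + by move=> _ jc; case: (cG i); rewrite -jc.
  + by case: (cG i').
  + by [].
- apply: indep_sub (indep_extend hp sY (k0 := inr c) (D := B) _ _ _) => //.
  + move=> [i|j] /=.
      move=> [Di nG]; left; split; first by split=> // -[j Gij]; apply: nG; exists j; left.
      by move=> [ib]; apply: nG; exists c; right; rewrite ib.
    by move=> [i [Gij|[_ ->]]]; [left; split=> //; exists i|right].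
  + by apply: indep_sub iG => k [].
  + exact: pw.
Qed.

End Exchange.

(** * Finitely supported functions *)

Lemma In_mem (T : eqType) (x : T) (s : seq T) : List.In x s <-> x \in s.
Proof.
elim: s => [|y s IH] //=; rewrite inE; split.
  by move=> [->|/IH ->]; rewrite ?eqxx ?orbT.
by move=> /predU1P[->|/IH]; [left|right].
Qed.

Section FiniteSupport.
Variables (R : idomainType) (I : Type).
Implicit Types f g : I -> R.

Lemma fsupp_sub f g : (forall i, g i <> 0 -> f i <> 0) -> fsupp f -> fsupp g.
Proof. by move=> gf [s fs]; exists s => i /gf/fs. Qed.

Lemma fsupp_uniq f : fsupp f ->
  exists s : seq {classic I}, uniq s /\ forall i, f i <> 0 -> (i : {classic I}) \in s.
Proof.
move=> [s fs]; exists (undup (s : seq {classic I})); split; first exact: undup_uniq.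
by move=> i /fs; rewrite mem_undup => /(@In_mem {classic I}).
Qed.

Lemma fsupp_mem (s : seq {classic I}) f :
  (forall i, f i <> 0 -> (i : {classic I}) \in s) -> fsupp f.
Proof. by move=> fs; exists s => i /fs /(@In_mem {classic I}). Qed.

Lemma fsupp0 : fsupp (fun _ : I => 0 : R).
Proof. by exists [::]. Qed.

Lemma fsuppD f g : fsupp f -> fsupp g -> fsupp (fun i => f i + g i).
Proof.
move=> [s fs] [t gt]; exists (s ++ t) => i fg; apply/List.in_or_app.
have [f0|/eqP/fs] := eqVneq (f i) 0; last by left.
by right; apply: gt => g0; apply: fg; rewrite f0 g0 addr0.
Qed.

Lemma fsuppZ r f : fsupp f -> fsupp (fun i => r * f i).
Proof. by apply: fsupp_sub => i rf f0; apply: rf; rewrite f0 mulr0. Qed.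

Definition unitv (i : I) : I -> R :=
  fun j => ((j : {classic I}) == (i : {classic I}))%:R.

Lemma fsupp_unitv i : fsupp (unitv i).
Proof.
apply: (fsupp_mem (s := [:: i])) => j; rewrite /unitv inE.
by case: (_ == _).
Qed.

End FiniteSupport.

(** * Coordinates in a decomposition of [M / W], and the filtration by order *)

Section Coordinates.
Variables (R : idomainType) (p : R).
Hypothesis hp : dvr_uniformizer p.
Variables (M : lmodType R) (W : M -> Prop).
Hypothesis sW : submod W.
Variables (I : Type) (n : I -> nat) (phi : (I -> R) -> M).
Hypothesis iso : qiso p n W phi.
Implicit Types f g : I -> R.

Lemma qisoD f g : fsupp f -> fsupp g ->
  W (phi (fun i => f i + g i) - (phi f + phi g)).
Proof. by case: iso => h _ _ _ _; apply: h. Qed.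

Lemma qisoZ r f : fsupp f -> W (phi (fun i => r * f i) - r *: phi f).
Proof. by case: iso => _ h _ _ _; apply: h. Qed.

Lemma qiso_onto x : exists f, fsupp f /\ W (x - phi f).
Proof. by case: iso. Qed.

Lemma qiso0 : W (phi (fun=> 0)).
Proof.
have := qisoZ 0 (@fsupp0 R I); rewrite scale0r subr0.
by congr (W (phi _)); apply/funext => i; rewrite mul0r.
Qed.

Lemma qiso_eq0 f : fsupp f -> W (phi f) -> forall i, dvdR (p ^+ n i) (f i).
Proof.
move=> sf Wf i; case: iso => _ _ _ /(_ f (fun=> 0) sf (@fsupp0 R I)) h _.
by have := h (submodB sW Wf qiso0) i; rewrite subr0.
Qed.

Lemma qiso_dvd f : fsupp f -> (forall i, dvdR (p ^+ n i) (f i)) -> W (phi f).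
Proof.
move=> sf df; case: iso => _ _ /(_ f (fun=> 0) sf (@fsupp0 R I)) h _ _.
by apply: (submod_sub sW (h _) qiso0) => i; rewrite subr0.
Qed.

Lemma qisoBZ f g r : fsupp f -> fsupp g ->
  W (phi (fun i => f i - r * g i) - (phi f - r *: phi g)).
Proof.
move=> sf sg.
have -> : (fun i => f i - r * g i) = (fun i => f i + (- r) * g i).
  by apply/funext => i; rewrite mulNr.
have := submodD sW (qisoD sf (fsuppZ (- r) sg)) (qisoZ (- r) sg).
by rewrite scaleNr !opprD !opprK !addrA subrK.
Qed.

Lemma fsuppBZ f g r : fsupp f -> fsupp g -> fsupp (fun i => f i - r * g i).
Proof.
move=> sf sg; have := fsuppD sf (fsuppZ (- r) sg).
by congr (fsupp _); apply/funext => i; rewrite mulNr.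
Qed.

Lemma qiso_eqBZ f g r : fsupp f -> fsupp g -> W (phi f - r *: phi g) ->
  forall i, dvdR (p ^+ n i) (f i - r * g i).
Proof.
move=> sf sg Wfg; apply: qiso_eq0; first exact: fsuppBZ.
exact: (submod_sub sW (qisoBZ r sf sg)).
Qed.

(** Since [phi] is linear only modulo [W], the expansion splits off one coordinate at a time. *)
Lemma qiso_sum (s : seq {classic I}) f : uniq s ->
  (forall i, f i <> 0 -> (i : {classic I}) \in s) ->
  W (phi f - \sum_(i <- s) f i *: phi (unitv R i)).
Proof.
elim: s f => [|j s IH] f /=.
  move=> _ f0; rewrite big_nil subr0 (_ : f = fun=> 0); first exact: qiso0.
  by apply/funext => i; apply: contrapT => /f0.
move=> /andP[js us] fs; pose g i := if (i : {classic I}) == j then 0 else f i.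
have gs i : g i <> 0 -> (i : {classic I}) \in s.
  by rewrite /g; case: eqVneq => // ij /fs; rewrite inE (negbTE ij).
have fE : f = (fun i => f j * unitv R j i + g i).
  apply/funext => i; rewrite /unitv /g; case: eqVneq => [->|_].
    by rewrite mulr1 addr0.
  by rewrite mulr0 add0r.
have := IH g us gs; rewrite big_cons.
rewrite [X in phi g - X](_ : _ = \sum_(i <- s) f i *: phi (unitv R i)); last first.
  by apply: eq_big_seq => i si; rewrite /g; case: eqVneq si js => // -> ->.
have h1 := qisoD (fsuppZ (f j) (fsupp_unitv R j)) (fsupp_mem gs).
rewrite -fE in h1.
have h2 := submodD sW h1 (qisoZ (f j) (fsupp_unitv R j)) => h3.
have := submodD sW h2 h3; congr W.
set a := phi f; set c := phi (fun i => f j * _); set d := f j *: _; set e := \sum_(i <- s) _; set b := phi g.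
by rewrite -addrA [c - d + _]addrACA addrA subrK opprD.
Qed.

Lemma qiso_ind V f : submod V -> (forall x, W x -> V x) -> fsupp f ->
  (forall i, f i <> 0 -> V (f i *: phi (unitv R i))) -> V (phi f).
Proof.
move=> sV WV /fsupp_uniq[s [us fs]] Vf; have := WV _ (qiso_sum us fs).
move=> /(submod_sub sV); apply; apply: submod_sum => // i _.
have [->|/eqP/Vf//] := eqVneq (f i) 0; rewrite scale0r; exact: submod0.
Qed.

Lemma qiso_unitv_exp i : W (p ^+ n i *: phi (unitv R i)).
Proof.
have si := fsupp_unitv R i; apply: (submod_sub sW (submodBC sW (qisoZ (p ^+ n i) si))).
by apply: qiso_dvd (fsuppZ _ si) _ => j; rewrite /unitv; case: eqVneq => [->|_];
  [exact: dvdR_expM|rewrite mulr0; exact: dvdR0].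
Qed.

(* The preimage in [M] of the part of [M / W] generated by the given cyclic
   summands of order at most [p ^+ m]. *)
Definition layer (m : nat) (x : M) : Prop :=
  exists f, [/\ fsupp f, forall i, (m < n i)%N -> f i = 0 & W (x - phi f)].

Lemma layer_base m x : W x -> layer m x.
Proof.
by exists (fun=> 0); split=> //; [exact: fsupp0|apply: submodB => //; exact: qiso0].
Qed.

Lemma submod_layer m : submod (layer m).
Proof.
split; first by apply: layer_base; apply: submod0.
- move=> x y [f [sf f0 Wf]] [g [sg g0 Wg]].
  exists (fun i => f i + g i); split; first exact: fsuppD.
    by move=> i mi; rewrite f0 // g0 // addr0.
  have := submodD sW (submodD sW Wf Wg) (submodBC sW (qisoD sf sg)).
  set a := phi f; set b := phi g; congr W.
  by rewrite [x - a + _]addrACA -opprD addrA subrK.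
- move=> r x [f [sf f0 Wf]]; exists (fun i => r * f i); split; first exact: fsuppZ.
    by move=> i mi; rewrite f0 // mulr0.
  have := submodD sW (submodZ r sW Wf) (submodBC sW (qisoZ r sf)).
  by rewrite scalerBr addrA subrK.
Qed.

Lemma layer_mono m m' x : (m <= m')%N -> layer m x -> layer m' x.
Proof.
move=> mm [f [sf f0 Wf]]; exists f; split=> // i mi; apply: f0.
exact: leq_ltn_trans mi.
Qed.

Lemma layer_phi m f : fsupp f -> (forall i, (m < n i)%N -> f i = 0) -> layer m (phi f).
Proof. by move=> sf f0; exists f; split=> //; rewrite subrr; apply: submod0. Qed.

Lemma layer_onto x : exists m, layer m x.
Proof.
have [f [sf Wf]] := qiso_onto x; have [s [us fs]] := fsupp_uniq sf.
exists (\max_(i <- s) n i); exists f; split => // i mi; apply: contrapT => /fs si.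
move: mi; rewrite ltnNge => /negP; apply.
exact: (@leq_bigmax_seq {classic I} s xpredT n).
Qed.

Lemma layer_exp m x : layer m x -> W (p ^+ m *: x).
Proof.
move=> [f [sf f0 Wf]]; have := submodZ (p ^+ m) sW Wf; rewrite scalerBr.
move=> /(submod_sub sW); apply.
apply: (submod_sub sW (submodBC sW (qisoZ (p ^+ m) sf))).
apply: (qiso_dvd (fsuppZ _ sf)) => i; have [nm|mn] := leqP (n i) m.
  by apply: (dvdR_exp nm); apply: dvdR_expM.
by rewrite f0 // mulr0; apply: dvdR0.
Qed.

(** In a summand with [m < n i], being killed by [p ^+ m] makes the coordinate divisible by
    [p ^+ (n i - m)], a positive power of [p]. *)
Lemma layer_ker m x : W (p ^+ m *: x) -> addS (layer m) (scaleS p) x.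
Proof.
move=> Wx; have [f [sf Wf]] := qiso_onto x.
have sL : submod (addS (layer m) (@scaleS _ M p)).
  by apply: submod_add; [apply: submod_layer|apply: submod_scale].
have WL y : W y -> addS (layer m) (@scaleS _ M p) y.
  by move=> /(layer_base m); apply: addSl; apply: submod_scale.
apply: (submod_sub sL (WL _ Wf)); apply: qiso_ind => // i _.
have [nm|mn] := leqP (n i) m.
  apply: submodZ => //; apply: addSl; first exact: submod_scale.
  apply: layer_phi; first exact: fsupp_unitv.
  move=> j; rewrite /unitv; case: eqVneq => [->|//].
  by rewrite ltnNge nm.
have {}Wf : W (phi (fun i => p ^+ m * f i)).
  apply: (submod_sub sW (qisoZ _ sf)).
  have := submodZ (p ^+ m) sW (submodBC sW Wf); rewrite scalerBr.
  by move=> /(submod_sub sW); apply.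
have := qiso_eq0 (fsuppZ _ sf) Wf i => /(dvdR_exp_cancel hp (ltnW mn)).
move=> /(@dvdR_exp _ _ 1); rewrite subn_gt0 => /(_ mn)[c ->].
apply: addSr; first exact: submod_layer.
by exists (c *: phi (unitv R i)); rewrite scalerA mulrC.
Qed.

(** The coordinates of [y] in summands with [m < n i] are already killed by [p], so truncating [y]
    does not change [p *: y] modulo [W]. *)
Lemma layer_scale m y : layer m (p *: y) ->
  exists2 y', layer m y' & W (p *: y - p *: y').
Proof.
move=> [f [sf f0 Wf]]; have [g [sg Wg]] := qiso_onto y.
have fg := qiso_eqBZ (r := p) sf sg.
have /fg{}fg : W (phi f - p *: phi g).
  have := submodD sW (submodBC sW Wf) (submodZ p sW Wg).
  by rewrite scalerBr addrA subrK.
pose h i := if (n i <= m)%N then g i else 0.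
have sh : fsupp h by apply: fsupp_sub sg => i; rewrite /h; case: ifP.
exists (phi h); first by apply: layer_phi => // i mi; rewrite /h leqNgt mi.
have : W (phi f - p *: phi h).
  apply: (submod_sub sW (submodBC sW (qisoBZ p sf sh))).
  apply: qiso_dvd; first exact: fsuppBZ.
  move=> i; rewrite /h; case: leqP => [_|/f0 ->]; first exact: fg.
  by rewrite mulr0 subr0; apply: dvdR0.
by move=> /(submodD sW Wf); rewrite addrA subrK.
Qed.

(** Summands with [n i <= m <= h] are killed by [p ^+ h], so an element of the layer divisible by
    [p ^+ h] modulo [W] has zero coordinates. *)
Lemma layer_height m h x y : (m <= h)%N -> layer m x -> W (x - p ^+ h *: y) -> W x.
Proof.
move=> mh [f [sf f0 Wf]] Wxy; have [g [sg Wg]] := qiso_onto y.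
have fg := qiso_eqBZ (r := p ^+ h) sf sg.
have /fg{}fg : W (phi f - p ^+ h *: phi g).
  have := submodD sW (submodD sW (submodBC sW Wf) Wxy) (submodZ (p ^+ h) sW Wg).
  by rewrite scalerBr !addrA !subrK.
apply: (submod_sub sW Wf); apply: qiso_dvd => // i.
have [nm|mn] := leqP (n i) m; last by rewrite f0 //; apply: dvdR0.
rewrite -(subrK (p ^+ h * g i) (f i)); apply: dvdRD => //.
by apply: dvdR_exp (leq_trans nm mh) (dvdR_expM _ _ _).
Qed.

Lemma layer0 x : (forall i, (0 < n i)%N) -> layer 0 x -> W x.
Proof.
move=> n0 [f [sf f0 Wf]]; apply: (submod_sub sW Wf).
by apply: qiso_dvd => // i; rewrite f0 //; apply: dvdR0.
Qed.

End Coordinates.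

(** * From a basis to an isomorphism with a direct sum *)

Section Bases.
Variables (R : idomainType) (p : R).
Variables (M : lmodType R) (I : Type) (n : I -> nat).
Let J : choiceType := {classic I}.
Variable z : J -> M.

Lemma sum_supp (s t : seq J) (f : J -> R) : uniq s -> uniq t ->
  (forall i, f i <> 0 -> i \in s) -> (forall i, f i <> 0 -> i \in t) ->
  \sum_(i <- s) f i *: z i = \sum_(i <- t) f i *: z i.
Proof.
have red (u : seq J) : \sum_(i <- u) f i *: z i = \sum_(i <- filter (fun i => f i != 0) u) f i *: z i.
  rewrite (bigID (fun i => f i == 0)) /= big1 ?add0r ?big_filter //.
  by move=> i /eqP->; rewrite scale0r.
move=> us ut fs ft; rewrite (red s) (red t); apply: perm_big.
apply: uniq_perm; [exact: filter_uniq|exact: filter_uniq|] => i.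
by rewrite !mem_filter; case: eqVneq => //= /eqP fi; rewrite fs // ft.
Qed.

Lemma qiso_of_basis :
  (forall i, p ^+ n i *: z i = 0) ->
  (forall x, span (fun y => y = 0) z (fun=> True) x) ->
  (forall s r, uniq s -> \sum_(i <- s) r i *: z i = 0 ->
     forall i, i \in s -> dvdR (p ^+ n i) (r i)) ->
  exists phi, qiso p n (fun x : M => x = 0) phi /\
    forall (s : seq J) f, uniq s -> (forall i, f i <> 0 -> (i : J) \in s) ->
      phi f = \sum_(i <- s) f i *: z i.
Proof.
move=> zn zspan zind.
(* A support is chosen for each [f], with [[::]] as default; by [sum_supp] the value of [phi] does
   not depend on the choice. *)
have /choice[supp suppP] (f : I -> R) : exists s : seq J,
    fsupp f -> uniq s /\ forall i, f i <> 0 -> (i : J) \in s.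
  have [/fsupp_uniq[s ss]|nf] := pselect (fsupp f); first by exists s.
  by exists [::].
pose phi (f : I -> R) := \sum_(i <- supp f) f i *: z i; exists phi.
have phiE (s : seq J) (f : I -> R) : uniq s -> (forall i, f i <> 0 -> (i : J) \in s) ->
    phi f = \sum_(i <- s) f i *: z i.
  move=> us fs; have [uf ff] := suppP f (fsupp_mem fs); exact: sum_supp.
have phi2 (f g : I -> R) : fsupp f -> fsupp g -> exists s : seq J,
    [/\ uniq s, forall i, f i <> 0 -> (i : J) \in s &
                forall i, g i <> 0 -> (i : J) \in s].
  move=> /fsupp_uniq[s [us fs]] /fsupp_uniq[t [ut gt]].
  exists (undup (s ++ t)); split; first exact: undup_uniq.
    by move=> i /fs si; rewrite mem_undup mem_cat si.
  by move=> i /gt si; rewrite mem_undup mem_cat si orbT.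
split=> //; split.
- move=> f g sf sg; have [s [us fs gs]] := phi2 f g sf sg.
  rewrite (phiE s f) // (phiE s g) // (phiE s) //.
    by rewrite -big_split /=; under eq_bigr do rewrite scalerDl; rewrite subrr.
  move=> i fg; have [f0|/eqP/fs//] := eqVneq (f i) 0; apply: gs => g0.
  by apply: fg; rewrite f0 g0 addr0.
- move=> r f /fsupp_uniq[s [us fs]]; rewrite (phiE s f) // (phiE s) //.
    rewrite scaler_sumr; under eq_bigr do rewrite -scalerA.
    by rewrite subrr.
  by move=> i rf; apply: fs => f0; apply: rf; rewrite f0 mulr0.
- move=> f g sf sg fg; have [s [us fs gs]] := phi2 f g sf sg.
  rewrite (phiE s f) // (phiE s g) // -sumrB big1_seq // => i _.
  by rewrite -scalerBl; have [c ->] := fg i; rewrite -scalerA zn scaler0.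
- move=> f g sf sg; have [s [us fs gs]] := phi2 f g sf sg.
  rewrite (phiE s f) // (phiE s g) // -sumrB => fg0 i.
  have [si|nsi] := boolP ((i : J) \in s).
    apply: (zind s (fun i => f i - g i)) => //.
    by rewrite -[RHS]fg0; apply: eq_bigr => j _; rewrite scalerBl.
  have f0 : f i = 0 by apply: contrapT => /fs; apply/negP.
  have g0 : g i = 0 by apply: contrapT => /gs; apply/negP.
  by rewrite f0 g0 subr0; apply: dvdR0.
- move=> x; have [s [r [us _ xE]]] := span_sum (@submod_zero R M) (zspan x).
  pose f i := if (i : J) \in s then r i else 0.
  have fs i : f i <> 0 -> (i : J) \in s by rewrite /f; case: ifP.
  exists f; split; first exact: fsupp_mem fs.
  rewrite (phiE s) // -[RHS]xE; congr (_ - _); apply: eq_big_seq => i si.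
  by rewrite /f si.
Qed.

End Bases.

(** * The graded criterion for a basis *)

Section GradedBasis.
Variables (R : idomainType) (p : R).
Hypothesis hp : dvr_uniformizer p.
Variable M : lmodType R.

(** Socle elements coming from order [h + 1] lie in [p ^+ h M] and are independent modulo
    [p ^+ h.+1 M], so the descending height filtration separates the orders. *)
Lemma socle_indep (K : choiceType) (D : K -> Prop) (n : K -> nat) (z : K -> M) :
  (forall k, D k -> (0 < n k)%N) -> (forall k, D k -> p ^+ n k *: z k = 0) ->
  (forall h, indep p (scaleS (p ^+ h.+1)) (fun k => p ^+ h *: z k)
     (fun k => D k /\ n k = h.+1)) ->
  indep p (fun x : M => x = 0) (fun k => p ^+ (n k).-1 *: z k) D.
Proof.
move=> n0 zn grad s r us sD; pose N := \max_(k <- s) n k.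
(* The heights are read backwards from the bound [N] so that [G] ascends: an element with
   [n k = N - t] has its socle element in [G t.+1]. *)
pose G t := @scaleS _ M (p ^+ (N - t)).
suff ind : indep p (fun x : M => x = 0) (fun k => p ^+ (n k).-1 *: z k)
    (fun k => D k /\ (n k <= N)%N).
  apply: ind us _ => k ks.
  by split; [exact: sD|exact: (@leq_bigmax_seq _ s xpredT n)].
apply: (indep_levels (G := G) (lv := fun k => N - n k)%N).
- exact: submod_zero.
- by move=> t; apply: submod_scale.
- by move=> y ->; apply: submod0; apply: submod_scale.
- move=> t _ [y ->]; have [tN|Nt] := ltnP t N.
    by exists (p *: y); rewrite scalerA -exprSr subnSK.
  by exists y; rewrite (_ : N - t.+1 = N - t)%N //; lia.
- move=> k [Dk nN]; exists (z k); congr (p ^+ _ *: _).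
  by have := n0 k Dk; lia.
- by move=> k [Dk _]; rewrite scalerA -exprS prednK ?n0 // zn.
- move=> t; have [tN|Nt] := ltnP t N; last first.
    move=> q v _ qD _ k kq; have [[Dk nN] tk] := qD k kq.
    by have := n0 k Dk; lia.
  have nt k : (n k <= N)%N -> (N - n k)%N = t -> n k = (N - t.+1).+1.
    by lia.
  rewrite /G -(subnSK tN); apply: (indep_map (f := id) (grad _)) => //.
  + by move=> k [[Dk nN] tk]; split => //; apply: nt.
  + by move=> k [[Dk nN] tk] /=; rewrite (nt k nN tk).
Qed.

(** Multiplying a relation by powers of [p] pushes it into the socle. Induction on [t] lowers the
    power of [p] needed to make each [r k] divisible by [p ^+ n k], until none is needed. *)
Lemma basis_indep (K : choiceType) (n : K -> nat) (z : K -> M) :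
  (forall k, (0 < n k)%N) ->
  indep p (fun x : M => x = 0) (fun k => p ^+ (n k).-1 *: z k) (fun=> True) ->
  forall s r, uniq s -> \sum_(k <- s) r k *: z k = 0 ->
    forall k, k \in s -> dvdR (p ^+ n k) (r k).
Proof.
move=> n0 soc s r us sz.
suff P t k : k \in s -> dvdR (p ^+ n k) (p ^+ (\max_(k <- s) n k - t) * r k).
  by move=> k /(P (\max_(k <- s) n k)); rewrite subnn mul1r.
elim: t k => [|t IH] k ks.
  rewrite subn0; apply: dvdR_exp (dvdR_expM _ _ _).
  exact: (@leq_bigmax_seq _ s xpredT n).
have [tN|Nt] := ltnP t (\max_(k <- s) n k); last first.
  suff <- : (\max_(k <- s) n k - t = \max_(k <- s) n k - t.+1)%N by apply: IH.
  by lia.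
set u := (_ - t.+1)%N; have uE : (\max_(k <- s) n k - t)%N = u.+1 by rewrite subnSK.
(* After multiplication by [p ^+ u] the relation has coefficients [q l] on the socle elements, so
   socle independence makes [p] divide [q k]. *)
have /choice[q qE] l : exists q, l \in s -> p ^+ u * r l = p ^+ (n l).-1 * q.
  have [ls|] := boolP (l \in s); last by exists 0.
  have := IH l ls; rewrite uE exprS -mulrA -[in p ^+ n l](prednK (n0 l)) exprS.
  by move=> /(dvdR_mulI (uniformizer_neq0 hp))[q ->]; exists q; rewrite mulrC.
have pq : dvdR p (q k).
  apply: (soc s) => //.
  transitivity (p ^+ u *: \sum_(k <- s) r k *: z k); last by rewrite sz scaler0.
  rewrite scaler_sumr; apply: eq_big_seq => l ls.
  by rewrite !scalerA qE // mulrC.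
have [c qc] := pq; exists c; rewrite qE // qc mulrCA -exprSr prednK //.
Qed.

Lemma graded_basis (K : choiceType) (D : K -> Prop) (n : K -> nat) (z : K -> M) :
  (forall k, D k -> (0 < n k)%N) -> (forall k, D k -> p ^+ n k *: z k = 0) ->
  (forall h, indep p (scaleS (p ^+ h.+1)) (fun k => p ^+ h *: z k)
     (fun k => D k /\ n k = h.+1)) ->
  (forall x, span (fun y => y = 0) z D x) ->
  exists phi : ({k | D k} -> R) -> M,
    qiso p (fun i => n (sval i)) (fun x : M => x = 0) phi /\
    forall (s : seq {classic {k | D k}}) f, uniq s ->
      (forall i, f i <> 0 -> (i : {classic {k | D k}}) \in s) ->
      phi f = \sum_(i <- s) f i *: z (sval i).
Proof.
move=> n0 zn grad zspan.
apply: (@qiso_of_basis _ p M {k | D k} (fun i => n (sval i)) (fun i => z (sval i))).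
- by move=> [k Dk] /=; apply: zn.
- move=> x; apply: span_sub (zspan x); first by move=> y; apply: span_base.
  by move=> k Dk; apply: (@span_gen _ _ _ _ (fun i : {k | D k} => z (sval i)) _ (exist _ k Dk)).
- apply: (@basis_indep {classic {k | D k}} (fun i => n (sval i))).
    by move=> [k Dk] /=; apply: n0.
  apply: (indep_map (f := fun i : {classic {k | D k}} => sval i) (socle_indep n0 zn grad)) => //.
    by move=> [k Dk].
  by move=> [k Dk] [l Dl] _ _ /= kl; apply: eq_exist.
Qed.

End GradedBasis.

(** * Uniqueness through invariants of the socle *)

Section Uniqueness.
Variables (R : idomainType) (p : R).
Hypothesis hp : dvr_uniformizer p.
Variables (M : lmodType R) (U : M -> Prop).
Hypothesis sU : submod U.

(* On the picket [P^n_k] the socle meets [p ^+ a M] iff [a < n], and it meets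
   [p ^+ c' U] iff [c' < k]; the latter condition is taken with [c = c' + 1]. *)
Definition socle_filt (a c : nat) (x : M) : Prop :=
  [/\ p *: x = 0, scaleS (p ^+ a) x &
      c = 0%N \/ exists2 u, U u & x = p ^+ c.-1 *: u].

Lemma submod_socle_filt a c : submod (socle_filt a c).
Proof.
have sa := @submod_scale _ M (p ^+ a); have sp := @submod_ker _ M p.
split.
- split; [exact: submod0 sp|exact: submod0 sa|right].
  by exists 0; [exact: submod0|rewrite scaler0].
- move=> x y [px ax cx] [py ay cy]; split; [exact: (submodD sp px py)|exact: (submodD sa ax ay)|].
  case: cx cy => [->|[u Uu ->]] [c0|[v Uv ->]]; [by left|by left|by left|right].
  by exists (u + v); [exact: submodD|rewrite scalerDr].
- move=> r x [px ax cx]; split; [exact: (submodZ r sp px)|exact: (submodZ r sa ax)|].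
  case: cx => [->|[u Uu ->]]; [by left|right].
  by exists (r *: u); [exact: submodZ|rewrite !scalerA mulrC].
Qed.

Section Decomposition.
Variables (I : Type) (n k : I -> nat) (phi : (I -> R) -> M).
Hypothesis dec : picket_decomp_by p n k U phi.

Definition socle_gen (i : {classic I}) : M := p ^+ (n i).-1 *: phi (unitv R i).

Let iso : qiso p n (fun x : M => x = 0) phi. Proof. by case: dec. Qed.
Let s0 := @submod_zero R M.
Let n0 i : (0 < n i)%N. Proof. by case: dec => /(_ i)[]. Qed.

Let kn i : (k i <= n i)%N.
Proof.
by case: dec => /(_ i)[ni [->|->|->|->]] _ _ //; rewrite leq_subr.
Qed.

Let UE x : U x <-> exists f, [/\ fsupp f, dsum_sub p n k f & phi f = x].
Proof. by case: dec. Qed.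

Lemma phiZ r f : fsupp f -> phi (fun i => r * f i) = r *: phi f.
Proof. by move=> sf; apply/eqP; rewrite -subr_eq0; apply/eqP; apply: (qisoZ iso). Qed.

Lemma socle_filtP a c x : socle_filt a c x <->
  span (fun y => y = 0) socle_gen (fun i => (a < n i)%N /\ (c <= k i)%N) x.
Proof.
split=> [[px [y xy] cx]|]; last first.
  apply; first exact: submod_socle_filt.
    by move=> y ->; apply: submod0; apply: submod_socle_filt.
  move=> i [ai ci]; split.
  - by rewrite scalerA -exprS prednK // (qiso_unitv_exp s0 iso).
  - exists (p ^+ ((n i).-1 - a) *: phi (unitv R i)).
    by rewrite scalerA -exprD subnKC // -ltnS prednK.
  - case: c ci => [|c] ci; [by left|right].
    (* The case split turned [c] into [c.+1]. As [c.+1 <= k i], this element lies in [U], and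
       [p ^+ c] takes it to the socle generator. *)
    exists (p ^+ (n i - c.+1) *: phi (unitv R i)); last first.
      rewrite scalerA -exprD /socle_gen; congr (_ ^+ _ *: _) => /=.
      by rewrite -subn1 -addn1 addnC subnDA addnBA ?subnKC // ?subn1; have := kn i; lia.
    apply/UE; exists (fun j => p ^+ (n i - c.+1) * unitv R i j); split.
    + exact/fsuppZ/fsupp_unitv.
    + move=> j; rewrite /unitv; case: eqVneq => [->|_].
        by apply: dvdR_exp (dvdR_expM _ _ _); apply: leq_sub2l.
      by rewrite mulr0; apply: dvdR0.
    + exact/phiZ/fsupp_unitv.
have [f [sf /eqP]] := qiso_onto iso x; rewrite subr_eq0 => /eqP xf.
rewrite xf; apply: (qiso_ind s0 iso) => //; first exact: submod_span.
  by move=> _ ->; apply: submod0; apply: submod_span.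
move=> i _.
have pf : dvdR (p ^+ n i) (p * f i).
  by apply: (qiso_eq0 s0 iso (fsuppZ p sf)); rewrite phiZ // -xf.
have zero : dvdR (p ^+ n i) (f i) ->
    span (fun y => y = 0) socle_gen (fun i => (a < n i)%N /\ (c <= k i)%N)
      (f i *: phi (unitv R i)).
  move=> [q ->]; rewrite -scalerA (qiso_unitv_exp s0 iso) scaler0.
  apply: submod0; apply: submod_span.
(* If [x = p ^+ b *: phi g] and the [i]-th coordinate of the right side vanishes, so does that of
   [x]. Used with [b = a] when [n i <= a] and with [b = c.-1] when [k i < c]. *)
have diff b g : fsupp g -> x = p ^+ b *: phi g -> dvdR (p ^+ n i) (p ^+ b * g i) ->
    dvdR (p ^+ n i) (f i).
  move=> sg xg dg; rewrite -(subrK (p ^+ b * g i) (f i)); apply: dvdRD => //.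
  by apply: (qiso_eqBZ s0 iso) => //; rewrite -xf xg subrr.
have [na|an] := leqP (n i) a.
  apply: zero; have [g [sg /eqP]] := qiso_onto iso y; rewrite subr_eq0 => /eqP yg.
  by apply: (diff a g sg); [rewrite -yg|apply: dvdR_exp na (dvdR_expM _ _ _)].
have [ck|kc] := leqP c (k i).
  move: pf; rewrite -[in p ^+ n i](prednK (n0 i)) exprS.
  move=> /(dvdR_mulI (uniformizer_neq0 hp))[q ->]; rewrite -scalerA.
  apply: (submodZ q (submod_span _ _ _)).
  by apply: (@span_gen _ _ _ _ socle_gen (fun i => (a < n i)%N /\ (c <= k i)%N)).
apply: zero; case: cx kc => [->//|[u /UE[g [sg gk ug]] xu] kc].
apply: (diff c.-1 g sg); first by rewrite ug.
have [q ->] := gk i; rewrite mulrCA -exprD; apply: dvdR_mull.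
by apply: (@dvdR_exp _ _ _ (c.-1 + (n i - k i))); [lia|exists 1; rewrite mul1r].
Qed.

Lemma socle_gen_indep :
  indep p (fun x : M => x = 0) socle_gen (fun=> True).
Proof.
move=> s r us _ sz i si.
pose f j := if (j : {classic I}) \in s then p ^+ (n j).-1 * r j else 0.
have fs j : f j <> 0 -> (j : {classic I}) \in s by rewrite /f; case: ifP.
have := qiso_eq0 s0 iso (fsupp_mem fs) _ i.
rewrite {2}/f si -[in p ^+ n i](prednK (n0 i)) exprSr.
move=> h; apply: (dvdR_mulI _ (h _)); first exact/expf_neq0/uniformizer_neq0.
have /eqP := qiso_sum s0 iso us fs; rewrite subr_eq0 => /eqP ->.
rewrite -[RHS]sz; apply: eq_big_seq => j js.
by rewrite /f js /socle_gen scalerA mulrC.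
Qed.

End Decomposition.

(** [exchange] is applied for each type [(a.+1, c)] modulo [Y a c]. The injections glue because
    types are preserved, so images of different types are distinct. *)
Lemma picket_injection (I : Type) (n k : I -> nat) (phi : (I -> R) -> M)
    (J : Type) (n' k' : J -> nat) (psi : (J -> R) -> M) :
  picket_decomp_by p n k U phi -> picket_decomp_by p n' k' U psi ->
  exists f : I -> J, injective f /\ forall i, n' (f i) = n i /\ k' (f i) = k i.
Proof.
move=> dI dJ.
pose Y a c := addS (socle_filt a.+1 c) (socle_filt a c.+1).
have sY a c : submod (Y a c) by apply: submod_add; apply: submod_socle_filt.
have /choice[G GP] (ac : nat * nat) : exists G : I -> J -> Prop,
    [/\ forall i, n i = ac.1.+1 /\ k i = ac.2 -> exists j, G i j,
        forall i j, G i j -> n' j = ac.1.+1 /\ k' j = ac.2 &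
        forall i i' j, G i j -> G i' j -> i = i'].
  case: ac => a c /=.
  apply: (@exchange _ _ hp _ _ (sY a c) {classic I} {classic J}
    (socle_gen n phi) (socle_gen n' psi)).
  (* [Y a c] lies in the span of the socle generators of the other types, so [indep_span] yields
     independence modulo it. *)
  - pose B (i : {classic I}) := ~ (n i = a.+1 /\ k i = c).
    apply: (@indep_mono _ _ _ (span (fun y => y = 0) (socle_gen n phi) B)); last first.
      apply: indep_span; [exact: submod_zero| |by move=> i ? []].
      exact: indep_sub (socle_gen_indep dI).
    move=> _ [x [y [/(socle_filtP dI) hx /(socle_filtP dI) hy ->]]].
    apply: (submodD (submod_span _ _ _)).
      apply: span_sub hx => [x' x0|i [ai ci]]; first exact: span_base.
      by apply: (@span_gen _ _ _ _ (socle_gen n phi) B) => -[ni _]; move: ai; rewrite ni ltnn.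
    apply: span_sub hy => [x' x0|i [ai ci]]; first exact: span_base.
    by apply: (@span_gen _ _ _ _ (socle_gen n phi) B) => -[_ ki]; move: ci; rewrite ki ltnn.
  - move=> j _; apply: (submod_sub (sY a c)); last exact: (submod0 (sY a c)).
    have /(socle_filtP dJ)[-> _ _] : span (fun y => y = 0) (socle_gen n' psi)
        (fun j => (0 < n' j)%N /\ (0 <= k' j)%N) (socle_gen n' psi j).
      by apply: span_gen; split=> //; case: dJ => /(_ j)[].
    by rewrite subrr; apply: submod0.
  - move=> i [ni ki].
    (* [socle_filt a c] does not depend on a decomposition, so the generator expands in the second
       one; terms not of type [(a.+1, c)] fall into [Y a c]. *)
    have /(socle_filtP dI)/(socle_filtP dJ) : span (fun y => y = 0) (socle_gen n phi)
        (fun i => (a < n i)%N /\ (c <= k i)%N) (socle_gen n phi i).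
      by apply: span_gen; rewrite ni ki.
    apply: span_sub => [_ ->|j [aj cj]]; first exact: (submod0 (submod_span _ _ _)).
    have inF b d : (b < n' j)%N -> (d <= k' j)%N -> socle_filt b d (socle_gen n' psi j).
      by move=> bj ej; apply/(socle_filtP dJ); apply: span_gen.
    move: (aj) (cj); rewrite leq_eqVlt => /orP[/eqP naj|naj].
      rewrite leq_eqVlt => /orP[/eqP kcj|kcj].
        by apply: (@span_gen _ _ _ _ (socle_gen n' psi)); rewrite /= -naj -kcj.
      by move=> V _ YV _; apply: YV; apply: addSr; [apply: submod_socle_filt|apply: inF].
    by move=> _ V _ YV _; apply: YV; apply: addSl; [apply: submod_socle_filt|apply: inF].
have /choice[f fP] i : exists j, G ((n i).-1, k i) i j.
  have [tot _ _] := GP ((n i).-1, k i); apply: tot => /=.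
  by rewrite prednK //; case: dI => /(_ i)[].
have fnk i : n' (f i) = n i /\ k' (f i) = k i.
  have [_ /(_ _ _ (fP i))[/= -> ->] _] := GP ((n i).-1, k i).
  by rewrite prednK //; case: dI => /(_ i)[].
exists f; split=> // i i' ff.
have [ni ki] := fnk i; have [ni' ki'] := fnk i'.
have [_ _ inj] := GP ((n i).-1, k i); apply: (inj _ _ (f i)); first exact: fP.
by rewrite -ni -ki ff ni' ki'; apply: fP.
Qed.

Lemma picket_decomp_unique (I : Type) (n k : I -> nat) (phi : (I -> R) -> M)
    (J : Type) (n' k' : J -> nat) (psi : (J -> R) -> M) :
  picket_decomp_by p n k U phi -> picket_decomp_by p n' k' U psi ->
  exists sigma : I -> J,
    bijective sigma /\ forall i, n' (sigma i) = n i /\ k' (sigma i) = k i.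
Proof.
move=> dI dJ; have [f [fI fnk]] := picket_injection dI dJ.
have [g [gI gnk]] := picket_injection dJ dI.
have [sigma [bij sP]] := Cantor_Bernstein_choice fI gI.
exists sigma; split=> // i; case: (sP i) => [->|gi]; first exact: fnk.
by have [] := gnk (sigma i); rewrite gi.
Qed.

End Uniqueness.

(** * Existence when [pM <= U] *)

Section CosocleCase.
Variables (R : idomainType) (p : R).
Hypothesis hp : dvr_uniformizer p.
Variables (M : lmodType R) (U : M -> Prop).
Hypothesis sU : submod U.
Hypothesis hM : sigma_cyc p M.
Hypothesis pU : forall m : M, U (p *: m).

(** An index carries a flag ([true] if chosen in [U]), the [h] for which the summand is
    [R/(p ^+ h.+1)], and the element; the tags keep different stages disjoint. *)
Let K : choiceType := (bool * nat * M)%type.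
Let z (k : K) : M := k.2.

Lemma picket_decomp_cosocle :
  picket_decomp p U (fun n k => k = n \/ k = (n - 1)%N).
Proof.
have s0 := @submod_zero R M.
have [I [n [n0 [phi iso]]]] := hM.
pose L := layer (fun x : M => x = 0) n phi.
have sL m : submod (L m) by exact: (submod_layer s0 iso m).
have L1 m x : L m x -> L m.+1 x by apply: layer_mono.
pose Y h := addS (L h) (@scaleS _ M p).
have sY h : submod (Y h) by apply: submod_add => //; apply: submod_scale.
pose Y' h := addS U (L h).
have sY' h : submod (Y' h) by apply: submod_add.
have YY' h x : Y h x -> Y' h x.
  by move=> [a [_ [La [b ->] ->]]]; exists (p *: b), a; rewrite addrC.
pose DA h (k : K) := [/\ k.1 = (true, h), U (z k) & L h.+1 (z k)].
pose DB h (k : K) := k.1 = (false, h) /\ L h.+1 (z k).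
have /choice[A AP] h : exists A, [/\ forall k, A k -> DA h k, indep p (Y h) z A &
    forall k, DA h k -> span (Y h) z A (z k)].
  by apply: maximal_indep => // k _; apply: addSr => //; exists (z k).
have /choice[B BP] h : exists B, [/\ forall k, B k -> DB h k, indep p (Y' h) z B &
    forall k, DB h k -> span (Y' h) z B (z k)].
  by apply: maximal_indep => // k _; apply: addSl.
pose D (k : K) := if k.1.1 then A k.1.2 k else B k.1.2 k.
have DL k : D k -> L k.1.2.+1 (z k).
  by rewrite /D; case: k.1.1; [case: (AP k.1.2) => /(_ k) h _ _ /h[]|
    case: (BP k.1.2) => /(_ k) h _ _ /h[]].
have AD h k : A h k -> D k.
  by move=> Ak; have [/(_ k Ak)[k1 _ _] _ _] := AP h; rewrite /D k1.
have BD h k : B h k -> D k.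
  by move=> Bk; have [/(_ k Bk)[k1 _] _ _] := BP h; rewrite /D k1.
have DAB h k : D k -> k.1.2 = h -> A h k \/ B h k.
  by rewrite /D => + <-; case: k.1.1; [left|right].
have DU k : D k -> k.1.1 -> U (z k).
  by rewrite /D => + k1; rewrite k1; case: (AP k.1.2) => /(_ k) h _ _ /h[].
have indAB h : indep p (Y h) z (fun k => A h k \/ B h k).
  have [AD' iA _] := AP h; have [_ iB _] := BP h.
  apply: (indep_union (sY h) (sY' h)) => //; first exact: YY'.
    by move=> k /AD'[_ Uk _]; apply: addSl.
  by move=> k _; apply: addSr => //; exists (z k).
pose S m := span (fun x => x = 0) z (fun k => D k /\ (k.1.2 < m)%N).
have sS m : submod (S m) by exact: submod_span.
have SL m x : S m x -> L m x.
  apply; [exact: sL|by move=> _ ->; apply: submod0 (sL m)|].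
  by move=> k [/DL Lk km]; apply: layer_mono Lk.
(* First [L m.+1] is shown to lie in [S m.+1 + pM]. The [pM] part can be taken in [p (L m.+1)], so
   iterating leaves a remainder in [p ^+ m.+1 (L m.+1) = 0]. *)
have LS m x : L m x -> S m x.
  elim: m x => [|m IH] x Lx.
    by rewrite (layer0 s0 iso n0 Lx); apply: submod0.
  pose T := addS (S m.+1) (@scaleS _ M p).
  have sT : submod T by apply: submod_add => //; apply: submod_scale.
  have ST y : S m.+1 y -> T y by apply: addSl; apply: submod_scale.
  have LT y : L m y -> T y.
    move=> /IH h; apply: ST; apply: span_sub h => [w w0|k [Dk km]].
      exact: span_base.
    by apply: (@span_gen _ _ _ _ z); split=> //; apply: ltnW.
  have gen C y : (forall k, C k -> D k /\ k.1.2 = m) ->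
      forall V : M -> Prop, (forall w, V w -> T w) -> span V z C y -> T y.
    move=> CD V VT; apply=> // k /CD[Dk km]; apply: ST.
    by apply: (@span_gen _ _ _ _ z (fun k => D k /\ (k.1.2 < m.+1)%N)); rewrite km.
  have [AD' _ spA] := AP m; have [BD' _ spB] := BP m.
  have Tx y : L m.+1 y -> T y.
    move=> Ly; have /(span_sum (sY' m))[s [r [us sB [u [v [Uu Lv yE]]]]]] :
        span (Y' m) z (B m) y by apply: (spB ((false, m), y)).
    have Ls : L m.+1 (\sum_(k <- s) r k *: z k).
      apply: submod_sum => // k /sB/BD'[_ Lk]; exact: submodZ.
    have Ts : T (\sum_(k <- s) r k *: z k).
      apply: submod_sum => // k /sB Bk; apply: (submodZ _ sT); apply: ST.
      apply: (@span_gen _ _ _ _ z (fun k => D k /\ (k.1.2 < m.+1)%N)).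
      by split; [exact: BD Bk|have [-> _] := BD' k Bk].
    (* The [U]-component left by the [B]-terms again lies in [L m.+1], so it is covered by the
       [A]-terms. *)
    have Lu : L m.+1 u.
      have -> : u = y - \sum_(k <- s) r k *: z k - v by rewrite yE addrK.
      by apply: submodB => //; [exact: submodB|exact: L1].
    have Tu : T u.
      have sp : span (Y m) z (A m) u by apply: (spA ((true, m), u)).
      apply: gen sp; first by move=> k Ak; split; [exact: AD Ak|have [-> _ _] := AD' k Ak].
      move=> _ [a [b [La pb ->]]]; apply: (submodD sT); first exact: LT.
      exact: addSr.
    apply: (submod_sub sT _ Ts); rewrite yE; apply: (submodD sT) => //; exact: LT.
  have step t : exists a b, [/\ S m.+1 a, L m.+1 b & x = a + p ^+ t *: b].
    elim: t => [|t [a [b [Sa Lb ->]]]].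
      by exists 0, x; rewrite add0r scale1r; split => //; apply: submod0.
    have [c [_ [Sc [w ->] bE]]] := Tx b Lb.
    have Lw : L m.+1 (p *: w).
      have -> : p *: w = b - c by rewrite bE addrC addKr.
      by apply: submodB => //; apply: SL.
    have [w' Lw' /eqP] := layer_scale s0 iso Lw; rewrite subr_eq0 => /eqP ww'.
    exists (a + p ^+ t *: c), w'; split => //.
      by apply: (submodD (sS _)) => //; apply: (submodZ _ (sS _)).
    by rewrite bE scalerDr addrA ww' scalerA -exprSr.
  have [a [b [Sa Lb ->]]] := step m.+1.
  by rewrite (layer_exp s0 iso Lb) addr0.
have [|||x|psi [iso' psiE]] := graded_basis (M := M) hp (K := K) (D := D)
    (n := fun k => k.1.2.+1) (z := z).
- by [].
- by move=> k /DL Lk; apply: (layer_exp s0 iso Lk).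
- move=> h s r us sD [w Ew]; apply: (indAB h) => // [k /sD[Dk [kh]]|].
    exact: DAB.
  (* A relation modulo [p ^+ h.+1 M] among the [p ^+ h *: z k] becomes one among the [z k] modulo
     [Y h], because [layer_ker] puts the kernel of [p ^+ h] inside [Y h]. *)
  have /(layer_ker hp s0 iso) : p ^+ h *: (\sum_(k <- s) r k *: z k - p *: w) = 0.
    rewrite scalerBr scalerA -exprSr -Ew scaler_sumr -sumrB big1 // => k _.
    by rewrite !scalerA mulrC subrr.
  move=> Yw; apply: (submod_sub (sY h) Yw).
  by apply: addSr => //; exists w.
- have [m /LS Sx] := layer_onto iso x; apply: span_sub Sx => [w w0|k [Dk _]].
    exact: span_base.
  exact: (@span_gen _ _ _ _ z D).
pose b (i : {k | D k}) := (sval i).1.1.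
exists {k | D k}, (fun i => (sval i).1.2.+1),
  (fun i => if b i then (sval i).1.2.+1 else (sval i).1.2), psi.
split; last by move=> i; case: (b i); [left|right; rewrite subn1].
split=> //.
  move=> i; split=> //; case: (b i); first exact: Or44.
  by apply: Or43; rewrite subn1.
(* The elements flagged [false] are independent modulo [U], so in a member of [U] their coefficients
   are divisible by [p], as [P^n_(n-1)] requires. *)
have iU : indep p U z (fun k => D k /\ ~~ k.1.1).
  apply: (indep_levels (G := Y') (lv := fun k => k.1.2)) => //.
  - by move=> y Uy; apply: addSl.
  - by move=> t _ [u [v [Uu Lv ->]]]; exists u, v; split=> //; apply: L1.
  - by move=> k [/DL Lk _]; apply: addSr.
  - move=> t; have [_ iB _] := BP t; apply: indep_sub iB => k [[Dk kb] kt].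
    by move: Dk; rewrite /D (negbTE kb) kt.
move=> m; split=> [Um|[f [sf df <-]]]; last first.
  have [s [us fs]] := fsupp_uniq sf; rewrite (psiE s f us fs).
  apply: (submod_sum sU) => i _; have := df i.
  rewrite /b; case: ifP => [ib _|_].
    by apply: submodZ => //; apply: DU ib; case: (i).
  by rewrite subSnn expr1 => -[c ->]; rewrite -scalerA; apply: submodZ.
have [f [sf /eqP]] := qiso_onto iso' m; rewrite subr_eq0 => /eqP mf.
exists f; split=> // i; rewrite /b; case: ifP => ib.
  by rewrite subnn; exists (f i); rewrite mulr1.
rewrite subSnn expr1; have [s [us fs]] := fsupp_uniq sf.
have [si|/negP nsi] := boolP ((i : {classic {k | D k}}) \in s); last first.
  by rewrite (_ : f i = 0); [exact: dvdR0|apply: contrapT => /fs].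
move: Um; rewrite mf (psiE s f us fs).
rewrite (sum_filterC _ s f (fun i => b i)); set s1 := filter _ s; set s2 := filter _ s.
have Us1 : U (\sum_(j <- s1) f j *: z (sval j)).
  apply: (submod_sum sU) => j; rewrite mem_filter => /andP[jb _].
  by apply: submodZ => //; apply: DU jb; case: (j).
move=> /(submod_addKl sU Us1) Us2.
apply: (@indep_map _ _ _ U K {classic {k | D k}} z (fun i => z (sval i))
  (fun k => D k /\ ~~ k.1.1) (fun i => ~~ b i) (fun i => sval i) iU _ _ _ s2) => //.
- by move=> [k Dk].
- by move=> [k Dk] [l Dl] _ _ /= kl; apply: eq_exist.
- exact: filter_uniq.
- by move=> j; rewrite mem_filter => /andP[].
- by rewrite mem_filter /= /b ib.
Qed.

End CosocleCase.

(** * Existence when [pU = 0], and its converse *)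

Section SocleCase.
Variables (R : idomainType) (p : R).
Hypothesis hp : dvr_uniformizer p.
Variable M : lmodType R.

(** Height is measured in [M], not in [V]. *)
Definition divS (V : M -> Prop) (h : nat) (x : M) : Prop := V x /\ scaleS (p ^+ h) x.

Lemma submod_divS V h : submod V -> submod (divS V h).
Proof. by move=> sV; apply: submod_cap => //; apply: submod_scale. Qed.

Lemma scaleS_expS h (x : M) : scaleS (p ^+ h.+1) x -> scaleS (p ^+ h) x.
Proof. by move=> [y ->]; exists (p *: y); rewrite scalerA -exprSr. Qed.

(* A Kulikov-type argument: because [F m] contains only elements of height less
   than [m] outside [F 0], its elements can be listed by increasing [m] and
   decreasing height [h], and at each stage one chooses a basis modulo what
   precedes.  The result is a basis adapted to the height filtration. *)
Lemma height_basis (F : nat -> M -> Prop) :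
  (forall m, submod (F m)) -> (forall m x, F m x -> F m.+1 x) ->
  (forall m x, F m x -> p *: x = 0) ->
  (forall m h x, (m <= h)%N -> divS (F m) h x -> F 0%N x) ->
  exists A : nat -> nat * M -> Prop,
    [/\ forall h k, A h k -> exists m, divS (F m) h k.2,
        forall h, indep p (addS (divS (F 0%N) h) (scaleS (p ^+ h.+1))) snd (A h) &
        forall m h x, divS (F m) h x ->
          span (divS (F 0%N) h) (fun k : nat * (nat * M) => k.2.2)
            (fun k => (h <= k.1)%N /\ A k.1 k.2) x].
Proof.
move=> sF FS pF Fh.
pose Y h m := addS (divS (F m) h) (@scaleS _ M (p ^+ h.+1)).
have sY h m : submod (Y h m).
  by apply: submod_add; [apply: submod_divS|apply: submod_scale].
pose E h m (k : nat * M) := k.1 = m /\ divS (F m.+1) h k.2.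
have /choice[A AP] (hm : nat * nat) : exists A, [/\ forall k, A k -> E hm.1 hm.2 k,
    indep p (Y hm.1 hm.2) snd A &
    forall k, E hm.1 hm.2 k -> span (Y hm.1 hm.2) snd A k.2].
  apply: maximal_indep => // k [_ [/pF-> _]]; exact: submod0.
have F0 m x : F 0%N x -> F m x by elim: m => // m IH /IH/FS.
exists (fun h k => A (h, k.1) k); split.
- by move=> h k Ak; have [/(_ k Ak)[_ Ek] _ _] := AP (h, k.1); exists k.1.+1.
- move=> h; apply: (indep_levels (G := Y h) (lv := fst)) => //.
  + exact: (sY h 0%N).
  + by move=> t _ [a [b [[Fa ha] hb ->]]]; exists a, b; split=> //; split=> //; apply: FS.
  + move=> k Ak; have [/(_ k Ak)[_ Ek] _ _] := AP (h, k.1).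
    by apply: addSl => //; apply: submod_scale.
  + move=> k Ak; have [/(_ k Ak)[_ [/pF-> _]] _ _] := AP (h, k.1).
    exact: (submod0 (sY h 0%N)).
  + move=> t; have [_ iA _] := AP (h, t).
    by apply: indep_sub iA => k [Ak <-].
pose S h := span (divS (F 0%N) h) (fun k : nat * (nat * M) => k.2.2)
  (fun k => (h <= k.1)%N /\ A (k.1, k.2.1) k.2).
have sS h : submod (S h) by exact: submod_span.
have SS h x : S h.+1 x -> S h x.
  apply; first exact: sS.
    by move=> y [Fy hy]; apply: span_base; split=> //; apply: scaleS_expS.
  move=> k [hk Ak]; apply: (@span_gen _ _ _ _ (fun k : nat * (nat * M) => k.2.2)).
  by split=> //; apply: ltnW.
elim=> [|m IH] h x Fx; first exact: span_base.
(* Inside the induction on [m] runs one on decreasing height: for [h > m] the hypothesis [Fh] puts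
   [x] in [F 0]. Otherwise, modulo chosen elements, [x] is a sum of a term in [F m] and one of
   height [h.+1]. *)
suff H d : forall h x, (m.+1 <= h + d)%N -> divS (F m.+1) h x -> S h x.
  by apply: (H m.+1) => //; apply: leq_addl.
elim: d {h x Fx} => [|d IHd] h x hd Fx.
  apply: span_base; split; last by case: Fx.
  by apply: (Fh m.+1 h) => //; rewrite -(addn0 h).
have [AE _ spA] := AP (h, m).
have /(span_sum (sY h m))[s [r [us sA [a [b [ha hb xE]]]]]] : span (Y h m) snd (A (h, m)) x.
  by apply: (spA (m, x)).
have Fs : F m.+1 (\sum_(k <- s) r k *: k.2).
  by apply: (submod_sum (sF _)) => k /sA/AE[_ [Fk _]]; apply: submodZ.
have Fb : F m.+1 b.
  have -> : b = x - \sum_(k <- s) r k *: k.2 - a by rewrite xE addrC addKr.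
  apply: (submodB (sF _)); last by apply: FS; case: ha.
  by apply: (submodB (sF _)) => //; case: Fx.
have Ss : S h (\sum_(k <- s) r k *: k.2).
  apply: (submod_sum (sS h)) => k ks; apply: (submodZ _ (sS h)).
  have [km _] := AE k (sA k ks).
  apply: (@span_gen _ _ _ _ (fun k : nat * (nat * M) => k.2.2) _ (h, k)).
  by split=> //=; rewrite km; apply: sA.
apply: (submod_sub (sS h) _ Ss); rewrite xE; apply: (submodD (sS h)).
  exact: IH.
by apply: SS; apply: IHd => //; rewrite addSnnS.
Qed.

Variable U : M -> Prop.
Hypothesis sU : submod U.

Lemma submod_dsum_sub (I : Type) (n k : I -> nat) (phi : (I -> R) -> M) :
  qiso p n (fun x : M => x = 0) phi ->
  submod (fun x => exists f, [/\ fsupp f, dsum_sub p n k f & phi f = x]).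
Proof.
move=> iso; split.
- exists (fun=> 0); split; [exact: fsupp0|by move=> i; apply: dvdR0|].
  exact: (qiso0 iso).
- move=> _ _ [f [sf df <-]] [g [sg dg <-]]; exists (fun i => f i + g i); split.
  + exact: fsuppD.
  + by move=> i; apply: dvdRD.
  + by apply/eqP; rewrite -subr_eq0; apply/eqP; apply: (qisoD iso).
- move=> r _ [f [sf df <-]]; exists (fun i => r * f i); split.
  + exact: fsuppZ.
  + by move=> i; apply: dvdR_mull.
  + by apply/eqP; rewrite -subr_eq0; apply/eqP; apply: (qisoZ iso).
Qed.

(** The quotient of [R/(p^n)] by [(p^(n-k))/(p^n)] is [R/(p^(n-k))]; [I'] discards the summands
    where it vanishes. *)
Lemma sigma_cyc_quot_of_picket_decomp (I : Type) (n k : I -> nat) (phi : (I -> R) -> M) :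
  picket_decomp_by p n k U phi -> sigma_cyc_quot p U.
Proof.
move=> [_ iso UE]; have s0 := @submod_zero R M.
have UP f : fsupp f -> U (phi f) <-> dsum_sub p n k f.
  move=> sf; split=> [/UE[g [sg dg gf]] i|df]; last by apply/UE; exists f.
  have := qiso_eqBZ s0 iso (r := 1) sf sg; rewrite gf scale1r subrr => /(_ erefl i).
  move=> /(dvdR_exp (leq_subr (k i) (n i))) h; rewrite -(subrK (1 * g i) (f i)).
  by apply: dvdRD => //; rewrite mul1r; apply: dg.
pose I' := {i : I | (0 < n i - k i)%N}.
(* Extension by zero from [I'] to [I]. *)
pose ext (f : I' -> R) (i : I) : R :=
  if pselect (0 < n i - k i)%N is left h then f (exist _ i h) else 0.
have extE f (i : I') : ext f (sval i) = f i.
  rewrite /ext; case: pselect => [h|nh]; last by case: nh; case: (i).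
  by congr f; case: i h => i h' h; apply: eq_exist.
have sext f : fsupp f -> fsupp (ext f).
  move=> [s fs]; exists (map sval s) => i; rewrite /ext; case: pselect => // h /fs h'.
  exact: (List.in_map sval s _ h').
have dext f : dsum_sub p n k (ext f) <-> forall i : I', dvdR (p ^+ (n (sval i) - k (sval i))) (f i).
  split=> [h i|h i]; first by rewrite -extE; apply: h.
  rewrite /ext; case: pselect => [h'|_]; last exact: dvdR0.
  exact: (h (exist _ i h')).
have extB f g : (fun i => ext f i - 1 * ext g i) = ext (fun i => f i - g i).
  by apply/funext => i; rewrite mul1r /ext; case: pselect => // _; rewrite subr0.
have Ueq f g : fsupp f -> fsupp g -> U (phi (ext f) - phi (ext g)) <->
    dsum_eq p (fun i : I' => n (sval i) - k (sval i))%N f g.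
  move=> sf sg; have /eqP := qisoBZ s0 iso 1 (sext f sf) (sext g sg).
  rewrite subr_eq0 scale1r => /eqP <-; rewrite extB.
  have sB : fsupp (ext (fun i => f i - g i)).
    by rewrite -extB; apply: fsuppBZ; apply: sext.
  by split=> [/(UP _ sB)/dext//|h]; apply/(UP _ sB)/dext.
exists I', (fun i => n (sval i) - k (sval i))%N; split; first by case.
exists (fun f => phi (ext f)); split.
- move=> f g /sext sf /sext sg.
  have -> : ext (fun i => f i + g i) = (fun i => ext f i + ext g i).
    by apply/funext => i; rewrite /ext; case: pselect => // _; rewrite addr0.
  by rewrite (qisoD iso sf sg); apply: submod0.
- move=> r f /sext sf.
  have -> : ext (fun i => r * f i) = (fun i => r * ext f i).
    by apply/funext => i; rewrite /ext; case: pselect => // _; rewrite mulr0.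
  by rewrite (qisoZ iso r sf); apply: submod0.
- by move=> f g sf sg h; apply/Ueq.
- by move=> f g sf sg h; apply/Ueq.
- move=> x; have [f [sf /eqP]] := qiso_onto iso x; rewrite subr_eq0 => /eqP ->.
  have sf' : fsupp (fun i : I' => f (sval i)).
    have [s [us fs]] := fsupp_uniq sf.
    exists (pmap (fun i : I => if pselect (0 < n i - k i)%N is left h
       then Some (exist _ i h : I') else None) s) => -[i h] /= /fs.
    elim: s {us fs} => //= j s IH; rewrite inE => /predU1P[<-|/IH]; last first.
      by case: pselect => // ?; right.
    case: pselect => [h'|//] /=; left; exact: eq_exist.
  exists (fun i => f (sval i)); split => //.
  have /eqP := qisoBZ s0 iso 1 sf (sext _ sf'); rewrite subr_eq0 scale1r => /eqP <-.
  apply/UP; first by apply: fsuppBZ => //; apply: sext.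
  move=> i; rewrite mul1r /ext; case: pselect => [h|/negP] /=.
    by rewrite subrr; apply: dvdR0.
  rewrite -leqNgt leqn0 => /eqP ->; exists (f i - 0); by rewrite mulr1.
Qed.

Hypothesis hM : sigma_cyc p M.
Hypothesis pU : forall u : M, U u -> p *: u = 0.

(** An index carries a flag ([true] for the basis of [U]), a height [h] giving a summand
    [R/(p ^+ h.+1)], the filtration stage, and the socle element. *)
Let K : choiceType := (bool * (nat * (nat * M)))%type.

Lemma picket_decomp_socle :
  sigma_cyc_quot p U -> picket_decomp p U (fun n k => k = 0%N \/ k = 1%N).
Proof.
have s0 := @submod_zero R M.
have [I [n [n0 [phi iso]]]] := hM; move=> [J [n' [n'0 [psi iso']]]].
(* [F1] starts at [0] and exhausts [U]; [F2] starts at [U] and exhausts [M[p]]. Hence the second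
   basis is taken modulo what the first one spans. *)
pose F1 m x := U x /\ layer (fun x : M => x = 0) n phi m x.
pose F2 m x := p *: x = 0 /\ layer U n' psi m x.
have sL1 m := submod_layer s0 iso m; have sL2 m := submod_layer sU iso' m.
have sp := @submod_ker _ M p.
have sF1 m : submod (F1 m) by exact: submod_cap.
have sF2 m : submod (F2 m) by exact: submod_cap.
have F10 x : F1 0%N x -> x = 0 by move=> [_]; apply: (layer0 s0 iso).
have F20 x : F2 0%N x <-> U x.
  split=> [[_]|Ux]; first exact: (layer0 sU iso').
  by split; [exact: pU|exact: (layer_base sU iso')].
have [||||A1 [A1F A1i A1s]] := height_basis (F := F1) => //.
- by move=> m x [Ux Lx]; split=> //; apply: layer_mono Lx.
- by move=> m x [/pU].
- move=> m h x mh [[Ux Lx] [y xy]].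
  have -> : x = 0 by apply: (layer_height s0 iso mh Lx (y := y)); rewrite xy subrr.
  exact: submod0.
have [||||A2 [A2F A2i A2s]] := height_basis (F := F2) => //.
- by move=> m x [px Lx]; split=> //; apply: layer_mono Lx.
- by move=> m x [].
- move=> m h x mh [[px Lx] [y xy]]; apply/F20.
  by apply: (layer_height sU iso' mh Lx (y := y)); rewrite xy subrr; apply: submod0.
pose D (k : K) := if k.1 then A1 k.2.1 k.2.2 else A2 k.2.1 k.2.2.
pose soc (k : K) : M := k.2.2.2.
have D1U k : D k -> k.1 -> U (soc k).
  by rewrite /D => + k1; rewrite k1 => /A1F[m [[]]].
have Dsoc k : D k -> p *: soc k = 0 /\ scaleS (p ^+ k.2.1) (soc k).
  rewrite /D; case: k.1 => [/A1F[m [[Uk _] hk]]|/A2F[m [[pk _] hk]]] //.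
  by split=> //; apply: pU.
(* Each socle element is divided by [p] as often as its recorded height allows; the quotients
   generate the summands. *)
have /choice[z zE] (k : K) : exists z, D k -> soc k = p ^+ k.2.1 *: z.
  by have [/Dsoc[_ [y yE]]|nD] := pselect (D k); [exists y|exists 0].
have spU h x : divS U h x -> span (fun y => y = 0) soc
    (fun k => [/\ D k, k.1 & (h <= k.2.1)%N]) x.
  move=> [Ux hx]; have [m Lx] := layer_onto iso x.
  have /(A1s m h) sp1 : divS (F1 m) h x by [].
  apply: (span_sub _ _ sp1) => [y [/F10 y0 _]|k [hk Ak]]; first exact: span_base.
  exact: (@span_gen _ _ _ _ soc (fun k => [/\ D k, k.1 & (h <= k.2.1)%N]) (true, k)).
have spS h x : p *: x = 0 -> scaleS (p ^+ h) x ->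
    span (fun y => y = 0) soc (fun k => D k /\ (h <= k.2.1)%N) x.
  move=> px hx; have [m Lx] := layer_onto iso' x.
  have /(A2s m h) sp2 : divS (F2 m) h x by [].
  apply: (span_sub _ _ sp2) => [y [/F20 Uy hy]|k [hk Ak]]; last first.
    exact: (@span_gen _ _ _ _ soc (fun k => D k /\ (h <= k.2.1)%N) (false, k)).
  apply: (span_sub _ _ (spU h y _)) => // [w w0|k [Dk _ hk]]; first exact: span_base.
  exact: (@span_gen _ _ _ _ soc (fun k => D k /\ (h <= k.2.1)%N)).
have [|||x|xi [iso2 xiE]] := graded_basis (M := M) hp (K := K) (D := D)
    (n := fun k => k.2.1.+1) (z := z).
- by [].
- by move=> k Dk; rewrite exprS -scalerA -zE //; case: (Dsoc k Dk).
- move=> h; pose Y := @scaleS _ M (p ^+ h.+1).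
  pose Y' := addS (divS (F2 0%N) h) Y.
  pose Db b (k : K) := [/\ D k, k.1 = b & k.2.1 = h].
  have sY : submod Y by exact: submod_scale.
  have sd V : submod V -> submod (divS V h) by apply: submod_divS.
  have sY' : submod Y' by apply: submod_add => //; apply: sd.
  (* At fixed [h] the flagged elements lie in [U], and the others are independent modulo the part of
     [U] of height at least [h] plus [p ^+ h.+1 M], as [indep_union] requires. *)
  have i12 : indep p Y soc (fun k => Db true k \/ Db false k).
    apply: (indep_union sY sY').
    + by move=> y; apply: addSr; apply: sd.
    + move=> k [Dk k1 kh]; apply: addSl => //; split; first by apply/F20/D1U; rewrite ?k1.
      by rewrite -kh; case: (Dsoc k Dk).
    + by move=> k [Dk _ _]; rewrite (proj1 (Dsoc k Dk)); apply: submod0.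
    + apply: (indep_map (f := fun k : K => k.2.2) (D := A1 h) (z := snd)) => //.
      * by apply: indep_mono (A1i h) => y; apply: addSr; apply: sd.
      * by move=> k [Dk k1 <-]; move: Dk; rewrite /D k1.
      * by move=> [b [h1 k]] [b' [h2 l]] [_ /= -> ->] [_ /= -> ->] ->.
    + apply: (indep_map (f := fun k : K => k.2.2) (A2i h)) => //.
      * by move=> k [Dk k1 <-]; move: Dk; rewrite /D k1.
      * by move=> [b [h1 k]] [b' [h2 l]] [_ /= -> ->] [_ /= -> ->] ->.
  apply: (indep_map (f := id) i12) => //.
    by move=> k [Dk [kh]]; case: (boolP k.1) => k1; [left|right; split=> //; apply/negbTE].
  by move=> k [Dk [kh]] /=; rewrite zE // kh.
- have [m Lx] := layer_onto iso x; have := layer_exp s0 iso Lx.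
  elim: m x {Lx} => [|m IH] x.
    by rewrite scale1r => ->; apply: (submod0 (submod_span _ _ _)).
  rewrite exprS -scalerA => px.
  pose S := span (fun y => y = 0) z D; have sS : submod S by exact: submod_span.
  have hx : scaleS (p ^+ m) (p ^+ m *: x) by exists x.
  (* The socle element [p ^+ m *: x] has height at least [m], so by [spS] it equals [p ^+ m *: s]
     with [s] in the span; then [p ^+ m] kills [x - s]. *)
  have [s Ss sE] : exists2 s, S s & p ^+ m *: x = p ^+ m *: s.
    apply: (spS m _ px hx (fun y => exists2 s, S s & y = p ^+ m *: s)).
    - split; first by exists 0; rewrite ?scaler0 //; apply: submod0.
      + move=> _ _ [a Sa ->] [b Sb ->].
        by exists (a + b); rewrite ?scalerDr //; apply: (submodD sS).
      + move=> r _ [a Sa ->]; exists (r *: a); first exact: (submodZ _ sS).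
        by rewrite !scalerA mulrC.
    - by move=> _ ->; exists 0; rewrite ?scaler0 //; apply: submod0.
    - move=> k [Dk mk]; exists (p ^+ (k.2.1 - m) *: z k).
        by apply: (submodZ _ sS); apply: (@span_gen _ _ _ _ z D k).
      by rewrite zE // scalerA -exprD subnKC.
  apply: (submod_sub sS _ Ss); apply: IH.
  by rewrite scalerBr sE subrr.
have xi1 (i : {k | D k}) : xi (unitv R i) = z (sval i).
  rewrite (xiE [:: i] (unitv R i)) //.
    by rewrite big_seq1 /unitv eqxx scale1r.
  by move=> j; rewrite /unitv inE; case: (_ == _).
pose deg (i : {k | D k}) := (sval i).2.1.+1.
(* The flag read as a number: [true] gives [P^n_1] and [false] gives [P^n_0]. *)
pose b (i : {k | D k}) : nat := (sval i).1.
exists {k | D k}, deg, b, xi.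
have allowed i : b i = 0%N \/ b i = 1%N by rewrite /b; case: (sval i).1; [right|left].
split=> //; split=> //.
  by move=> i; split=> //; case: (allowed i) => ->; [apply: Or41|apply: Or42].
have socE (i : {k | D k}) : soc (sval i) = p ^+ (sval i).2.1 *: z (sval i).
  by rewrite zE //; case: (i).
move=> m; split=> [Um|[f [sf df <-]]].
  have Um0 : divS U 0 m by split=> //; exists m; rewrite scale1r.
  have sV := submod_dsum_sub b iso2.
  apply: (spU 0%N m Um0 _ sV); first by move=> _ ->; apply: submod0 sV.
  move=> k [Dk k1 _]; pose i : {k | D k} := exist _ k Dk.
  exists (fun j => p ^+ (sval i).2.1 * unitv R i j); split.
  - exact/fsuppZ/fsupp_unitv.
  - move=> j; rewrite /unitv; case: eqVneq => [->|_].
      by rewrite /b /deg /= k1 subn1; apply: dvdR_expM.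
    by rewrite mulr0; apply: dvdR0.
  - have /eqP := qisoZ iso2 (p ^+ (sval i).2.1) (fsupp_unitv R i).
    by rewrite subr_eq0 xi1 -socE => /eqP.
apply: (qiso_ind s0 iso2) => // [_ ->|i _]; first exact: submod0.
rewrite xi1; have := df i; rewrite /b /deg.
case: (boolP (sval i).1) => i1.
  rewrite subn1 => -[c ->]; rewrite -scalerA -socE; apply: submodZ => //.
  by apply: D1U => //; case: (i).
rewrite subn0 => -[c ->]; rewrite exprS -!scalerA -socE.
have [-> _] := Dsoc (sval i) (svalP i); rewrite scaler0; exact: submod0.
Qed.

End SocleCase.

Theorem mainTheorem7 (R : idomainType) (p : R) (hp : dvr_uniformizer p)
  (M : lmodType R) (U : M -> Prop) (hU : submod U) (hM : sigma_cyc p M) :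
  [/\ (* (1) *)
      ((forall m : M, U (p *: m)) ->
         picket_decomp p U (fun n k => k = n \/ k = (n - 1)%N)),
      (* (2) *)
      ((forall u : M, U u -> p *: u = 0) ->
         (picket_decomp p U (fun n k => k = 0%N \/ k = 1%N)
          <-> sigma_cyc_quot p U)) &
      (* (3) *)
      (((forall m : M, U (p *: m)) \/ (forall u : M, U u -> p *: u = 0)) ->
       forall (I : Type) (n k : I -> nat) (phi : (I -> R) -> M)
              (J : Type) (n' k' : J -> nat) (psi : (J -> R) -> M),
         picket_decomp_by p n k U phi -> picket_decomp_by p n' k' U psi ->
         exists sigma : I -> J,
           bijective sigma /\ forall i, n' (sigma i) = n i /\ k' (sigma i) = k i)].
Proof.
split.
- exact: picket_decomp_cosocle.
- move=> pU; split; last exact: picket_decomp_socle.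
  by move=> [I [n [k [phi [dec _]]]]]; apply: sigma_cyc_quot_of_picket_decomp dec.
- by move=> _ I n k phi J n' k' psi; apply: picket_decomp_unique.
Qed.
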